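(* Consider binary data satisfying the orthogonal separability assumption, trained by gradient flow from a balanced $\epsilon$-scaled initialization whose shape is non-degenerate (all as defined in the context), with either the exponential or the logistic loss. Then there exists $\epsilon_0>0$ such that for every $\epsilon\in(0,\epsilon_0)$ and every gradient-flow solution $\theta(t)$, $t\ge 0$, the limit $\bar\theta:=\lim_{t\to\infty}\theta(t)/\|\theta(t)\|_F=(\bar W,\bar V)$ exists. Moreover, there exist $\bar\phi_+,\bar\phi_-\in\mathbb{S}^{h-1}$ such that: (1) (intra-class directional collapse) $\phi_{\bar\theta}(x_i)=\langle s_k u_k,x_i\rangle\,\bar\phi_k$ for all $i\in\mathcal I_k$, $k\in\{+,-\}$, where $s_k=\sqrt{\gamma_k^{-1}/\big(2(\gamma_+^{-1}+\gamma_-^{-1})\big)}$; (2) (orthogonal class means) $\bar\phi_+\ge 0$, $\bar\phi_-\ge 0$ entrywise and $\langle\bar\phi_+,\bar\phi_-\rangle=0$; (3) (self-duality) $\bar V=s_+\bar\phi_+^\top-s_-\bar\phi_-^\top$.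
   Context: Data: $x_1,\dots,x_n\in\mathbb{R}^D$ with labels $y_i\in\{-1,+1\}$; $\mathcal I_+=\{i:y_i=+1\}$, $\mathcal I_-=\{i:y_i=-1\}$, both nonempty. Orthogonal separability: there exist $\mu_s\in(0,1]$ and $\mu_d>0$ such that $\langle x_i,x_j\rangle\ge\mu_s\|x_i\|\|x_j\|$ whenever $y_i=y_j$ and $\langle x_i,x_j\rangle\le-\mu_d\|x_i\|\|x_j\|$ whenever $y_i\ne y_j$ (all $x_i\neq 0$). Network: width $h\ge 2$, parameters $\theta=(W,V)$ with $W=[w_1,\dots,w_h]\in\mathbb{R}^{D\times h}$, $V=[v_1,\dots,v_h]\in\mathbb{R}^{1\times h}$, $f(x;\theta)=\sum_{j=1}^h v_j\sigma(\langle w_j,x\rangle)$, $\sigma(z)=\max\{z,0\}$. Last-layer feature: $\phi_\theta(x)=(\sigma(\langle w_1,x\rangle),\dots,\sigma(\langle w_h,x\rangle))^\top\in\mathbb{R}^h$. Loss $\mathcal L(\theta)=\sum_i\ell(y_i,f(x_i;\theta))$ with $\ell(y,\hat y)=\exp(-y\hat y)$ or $\ell(y,\hat y)=2\log(1+\exp(-y\hat y))$. Gradient flow: an absolutely continuous curve $\theta(t)$ with $\frac{d}{dt}\theta(t)\in-\partial\mathcal L(\theta(t))$ for almost every $t\ge0$, where $\partial$ is the Clarke subdifferential. Initialization: there are $w_{j0}\in\mathbb{R}^D$, $v_{j0}\in\mathbb{R}$, nonzero, with $\|w_{j0}\|=|v_{j0}|$, and $w_j(0)=\epsilon w_{j0}$,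 $v_j(0)=\epsilon v_{j0}$. Let $\mathcal N_+=\{j:v_{j0}>0\}$, $\mathcal N_-=\{j:v_{j0}<0\}$. Non-degeneracy: with $\bar x_\pm=x_\pm/\|x_\pm\|$, $x_\pm=\sum_{i\in\mathcal I_\pm}x_i$: $\mathcal N_+,\mathcal N_-\ne\emptyset$; $\max_{i\in\mathcal I_+,j\in\mathcal N_+}\langle x_i,w_{j0}\rangle>0$ and $\max_{i\in\mathcal I_-,j\in\mathcal N_-}\langle x_i,w_{j0}\rangle>0$; $\max_{j\in\mathcal N_+}\langle\bar x_-,w_{j0}/\|w_{j0}\|\rangle<1$ and $\max_{j\in\mathcal N_-}\langle\bar x_+,w_{j0}/\|w_{j0}\|\rangle<1$. Class-wise max margin: for $k\in\{+,-\}$, $\gamma_k=\max_{u\in\mathbb{S}^{D-1}}\min_{i\in\mathcal I_k}\langle x_i,u\rangle$ and $u_k$ is the maximizing unit vector. *)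

(* Defs.v *)
From HB Require Import structures.
From mathcomp Require Import all_boot all_order all_algebra.
From mathcomp Require Import all_classical all_reals all_analysis.
Set Implicit Arguments. Unset Strict Implicit. Unset Printing Implicit Defensive.
Import Order.TTheory GRing.Theory Num.Theory.
Import numFieldNormedType.Exports.
Local Open Scope ring_scope.
Local Open Scope classical_set_scope.

Section Defs.
Variable R : realType.

Definition dotc m (u v : 'cV[R]_m) : R := \sum_(k < m) u k 0 * v k 0.
Definition enorm m (u : 'cV[R]_m) : R := Num.sqrt (dotc u u).

Definition frob_dot m n (A B : 'M[R]_(m, n)) : R :=
  \sum_(i < m) \sum_(j < n) A i j * B i j.
Definition frob m n (A : 'M[R]_(m, n)) : R := Num.sqrt (frob_dot A A).

Definition relu (z : R) : R := Num.max z 0.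

(* Parameters theta = (W, V) are stored as the stacked matrix
   col_mx V W : 'M_(1 + D, h), column j being (v_j ; w_j).
   Its Frobenius norm is sqrt(||W||_F^2 + ||V||_F^2) = ||theta||_F. *)
Definition Vpart D h (th : 'M[R]_(1 + D, h)) : 'rV[R]_h := usubmx th.
Definition Wpart D h (th : 'M[R]_(1 + D, h)) : 'M[R]_(D, h) := dsubmx th.

Definition feat D h (th : 'M[R]_(1 + D, h)) (x : 'cV[R]_D) : 'cV[R]_h :=
  \col_(j < h) relu (dotc (col j (Wpart th)) x).

Definition net D h (th : 'M[R]_(1 + D, h)) (x : 'cV[R]_D) : R :=
  \sum_(j < h) Vpart th 0 j * relu (dotc (col j (Wpart th)) x).

Inductive loss_kind := ExpLoss | LogisticLoss.

Definition ell (lk : loss_kind) (y yhat : R) : R :=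
  match lk with
  | ExpLoss => expR (- (y * yhat))
  | LogisticLoss => 2 * ln (1 + expR (- (y * yhat)))
  end.

Definition Loss (lk : loss_kind) n D h (x : 'I_n -> 'cV[R]_D) (y : 'I_n -> R)
  (th : 'M[R]_(1 + D, h)) : R :=
  \sum_(i < n) ell lk (y i) (net th (x i)).

(* Clarke subdifferential (Clarke's definition via the generalized
   directional derivative): xi \in dF(p) iff for every direction v,
   F°(p; v) := limsup_{q -> p, t downarrow 0} (F(q + t v) - F q)/t >= <xi, v>. *)
Definition clarke_subdiff m n (F : 'M[R]_(m, n) -> R) (p xi : 'M[R]_(m, n)) : Prop :=
  forall v : 'M[R]_(m, n), forall delta eta : R, 0 < delta -> 0 < eta ->
    exists (q : 'M[R]_(m, n)) (t : R),
      frob (q - p) < delta /\ 0 < t < delta /\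
      frob_dot xi v - eta < (F (q + t *: v) - F q) / t.

Definition abs_cont_on (f : R -> R) (a b : R) : Prop :=
  forall e : R, 0 < e -> exists d : R, 0 < d /\
    forall (k : nat) (l r : 'I_k -> R),
      (forall i, a <= l i /\ l i <= r i /\ r i <= b) ->
      (forall i j, i != j -> r i <= l j \/ r j <= l i) ->
      \sum_(i < k) (r i - l i) < d ->
      \sum_(i < k) `|f (r i) - f (l i)| < e.

Definition gradient_flow m n (F : 'M[R]_(m, n) -> R) (th : R -> 'M[R]_(m, n)) : Prop :=
  (forall (T : R) (i : 'I_m) (j : 'I_n), 0 < T -> abs_cont_on (fun t => th t i j) 0 T) /\
  (@lebesgue_measure R).-negligible
    [set t : R | 0 <= t /\
       ~ (exists g : 'M[R]_(m, n),
            (forall (i : 'I_m) (j : 'I_n),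
               derivable (fun s : R => th s i j) t 1 /\
               'D_1 (fun s : R => th s i j) t = g i j) /\
            clarke_subdiff F (th t) (- g))].

Definition orth_separable n D (x : 'I_n -> 'cV[R]_D) (y : 'I_n -> R) : Prop :=
  exists mus mud : R, 0 < mus /\ mus <= 1 /\ 0 < mud /\
    (forall i j, y i = y j -> mus * enorm (x i) * enorm (x j) <= dotc (x i) (x j)) /\
    (forall i j, y i <> y j -> dotc (x i) (x j) <= - (mud * enorm (x i) * enorm (x j))).

Definition class_sum n D (x : 'I_n -> 'cV[R]_D) (y : 'I_n -> R) (k : R) : 'cV[R]_D :=
  \sum_(i < n | y i == k) x i.
Definition class_dir n D (x : 'I_n -> 'cV[R]_D) (y : 'I_n -> R) (k : R) : 'cV[R]_D :=
  (enorm (class_sum x y k))^-1 *: class_sum x y k.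

Definition nondegenerate_init n D h (x : 'I_n -> 'cV[R]_D) (y : 'I_n -> R)
  (w0 : 'M[R]_(D, h)) (v0 : 'rV[R]_h) : Prop :=
  (exists j, 0 < v0 0 j) /\ (exists j, v0 0 j < 0) /\
  (exists i j, y i = 1 /\ 0 < v0 0 j /\ 0 < dotc (x i) (col j w0)) /\
  (exists i j, y i = -1 /\ v0 0 j < 0 /\ 0 < dotc (x i) (col j w0)) /\
  (forall j, 0 < v0 0 j ->
     dotc (class_dir x y (-1)) ((enorm (col j w0))^-1 *: col j w0) < 1) /\
  (forall j, v0 0 j < 0 ->
     dotc (class_dir x y 1) ((enorm (col j w0))^-1 *: col j w0) < 1).

Definition is_class_min n D (x : 'I_n -> 'cV[R]_D) (y : 'I_n -> R) (k : R)
  (u : 'cV[R]_D) (g : R) : Prop :=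
  (forall i, y i = k -> g <= dotc (x i) u) /\ (exists i, y i = k /\ dotc (x i) u = g).

Definition is_max_margin n D (x : 'I_n -> 'cV[R]_D) (y : 'I_n -> R) (k : R)
  (gam : R) (u : 'cV[R]_D) : Prop :=
  enorm u = 1 /\ is_class_min x y k u gam /\
  (forall u' g', enorm u' = 1 -> is_class_min x y k u' g' -> g' <= gam).

Definition s_coef (gk gp gm : R) : R :=
  Num.sqrt (gk^-1 / (2 * (gp^-1 + gm^-1))).

End Defs.

(* Main.v *)
(* The statement holds for every eps > 0, so eps0 = 1 works.  By orthogonal separability the
   activations y_k <w_j, x_k> of a neuron with v_j > 0 never decrease (symmetrically for
   v_j < 0), and v_j grows at most proportionally to each of them.  Hence a neuron either stays
   bounded, and is negligible after normalisation, or becomes active on its whole class and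
   inactive on the other one.  From then on the surviving neurons of a class follow the linear
   dynamics w_j' = v_j G, v_j' = <w_j, G> with G = sum_i g_i x_i and g_i comparable to
   exp (- q_i), where q_i = sum_j v_j <w_j, x_i>.  The quantities v_j v_k - <w_j, w_k> are
   conserved, so all directions w_j / v_j merge.  Since the weights g_i concentrate on the
   smallest q_i, v_j' is at most (gamma + o(1)) v_j sum_i g_i, while <w_j, u>' is at least
   gamma v_j sum_i g_i for the max-margin direction u; thus w_j / v_j tends to u.  Finally the
   ratios v_j / v_k converge and sum_j v_j ^ 2 is equivalent to (ln t) / gamma in each class,
   which gives the limit of theta / ||theta||. *)
Require Import Defs.
From HB Require Import structures.
From mathcomp Require Import all_boot all_order all_algebra.
From mathcomp Require Import all_classical all_reals all_analysis.
From mathcomp Require Import ring lra.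
Set Implicit Arguments. Unset Strict Implicit. Unset Printing Implicit Defensive.
Import Order.TTheory GRing.Theory Num.Theory.
Import numFieldNormedType.Exports.
Local Open Scope ring_scope.
Local Open Scope classical_set_scope.

(** * Absolutely continuous functions with almost everywhere derivatives *)

(** The flow satisfies only an inclusion, for almost every time, and at a kink of [relu] the
    subdifferential leaves the velocity of [w j] undetermined. What is kept of it is a lower bound
    for [dotc (dw j t) d], one for each test direction d. It becomes an equality in two situations:
    for d along [w j t], and once the activations of the neuron have left 0, where d and -d can both
    be tested. Nothing is integrated: each differential inequality is turned into a combination of
    functions whose derivative has a sign outside a null set, hence into a monotone function. The
    class -1 needs no separate analysis, since flipping all labels and all output weights maps the
    flow to one of the same kind. Limits are first taken after division by [Num.sqrt (ln t)], a
    scale common to both classes, and the Frobenius norm is divided out at the end. *)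

(** Compactness of the segment as an induction principle: a step leads from just left of the
    supremum of the points satisfying P to just right of it, so the supremum is b and is attained.
    The radius d may depend on s, as in Cousin's lemma. *)
Lemma segment_ind (R : realType) (P : R -> Prop) (a b : R) :
  a <= b -> P a ->
  (forall s, a <= s <= b -> exists2 d, 0 < d & forall t t', a <= t -> s - d < t ->
     t <= s -> s <= t' -> t' < s + d -> t' <= b -> P t -> P t') ->
  P b.
Proof.
move=> ab Pa step; pose E := [set t | a <= t <= b /\ P t].
have Ea : E a by split; rewrite ?lexx.
have Eb : ubound E b by move=> t [/andP[]].
have supE : has_sup E by split; [exists a|exists b].
have upE t : E t -> t <= sup E by exact: (sup_upper_bound supE).
have as_ : a <= sup E by exact: (upE _ Ea).
have sb : sup E <= b by apply: ge_sup => //; exists a.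
have [|d d0 st] := step (sup E); first by rewrite as_.
have [t [/andP[at_ tb] Pt] ts] := sup_adherent d0 supE.
have ts' : t <= sup E by apply: upE; split=> //; rewrite at_ tb.
have Pt' t' := st t t' at_ ts ts'.
have [be|sneb] := eqVneq b (sup E); first by apply: Pt' => //; lra.
have sltb : sup E < b by rewrite lt_neqAle eq_sym sneb.
pose t' := Num.min (sup E + d / 2) b.
have t's : sup E < t' by rewrite lt_min sltb andbT; lra.
have t'b : t' <= b by rewrite ge_min lexx orbT.
have : E t'.
  split; first by apply/andP; split=> //; lra.
  apply: Pt' => //; first exact: ltW.
  by rewrite gt_min; apply/orP; left; lra.
move/upE.
lra.
Qed.

(** The two one-sided bounds add up across t: an increment of f over a short interval containing t
    is at least [- eta] times its length, although f is differentiable at t only. *)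
Lemma derive_ge0_near (R : realType) (f : R -> R) (t l : R) :
  is_derive t 1 f l -> 0 <= l -> forall eta, 0 < eta -> exists2 d, 0 < d &
    forall s, `|s - t| < d ->
      (t <= s -> - eta * (s - t) <= f s - f t) /\
      (s <= t -> - eta * (t - s) <= f t - f s).
Proof.
move=> [df Df] l0 eta eta0.
have cv : h^-1 *: (f (h *: 1 + t) - f t) @[h --> 0^'] --> l.
  by rewrite -Df; exact: df.
have /(cvgr_gt l cv) : - eta < l by lra.
case/nbhs_ballP => d /= d0 H; exists d => // s sd.
have [->|st] := eqVneq s t; first by rewrite !subrr !mulr0.
have := H (s - t); rewrite /ball /= sub0r normrN => /(_ sd).
rewrite subr_eq0 => /(_ st); rewrite scaler1 subrK => K.
have K' : - eta < (f s - f t) / (s - t) by rewrite mulrC.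
split=> hs.
  have h : 0 < s - t by rewrite subr_gt0 lt_neqAle eq_sym st.
  by move: K'; rewrite ltr_pdivlMr// => /ltW.
have h : s - t < 0 by rewrite subr_lt0 lt_neqAle st.
by move: K'; rewrite ltr_ndivlMr// => K'; lra.
Qed.

(** Intervals are listed from right to left, so that an induction that moves to the right can
    prepend the newest one. *)
Lemma abs_cont_on_seq (R : realType) (f : R -> R) (a b e : R) :
  abs_cont_on f a b -> 0 < e -> exists2 d, 0 < d &
  forall s : seq (R * R), all (fun p => (a <= p.1) && (p.1 <= p.2) && (p.2 <= b)) s ->
    pairwise (fun p q => q.2 <= p.1) s ->
    \sum_(p <- s) (p.2 - p.1) < d -> \sum_(p <- s) `|f p.2 - f p.1| < e.
Proof.
move=> fac e0; have [d [d0 H]] := fac e e0; exists d => // s alls pw sd.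
have := H (size s) (fun i => (nth (0, 0) s i).1) (fun i => (nth (0, 0) s i).2).
rewrite !(big_nth (0, 0)) !big_mkord in sd *.
apply=> //.
  by move=> i; have /andP[/andP[]] := all_nthP (0, 0) alls i (ltn_ord i).
move=> i j ij; have /(pairwiseP (0, 0)) pw' := pw.
case: (ltngtP i j) => ij'.
- by right; apply: pw' => //; rewrite inE.
- by left; apply: pw' => //; rewrite inE.
- by move/eqP: ij => []; exact/val_inj.
Qed.

Lemma open_in_segment (R : realType) (U : set R) (s : R) : open U -> U s ->
  exists2 d, 0 < d & forall r, `|s - r| < d -> U r.
Proof.
move=> oU Us; have /nbhs_ballP[d /= d0 H] : nbhs s U by exact: open_nbhs_nbhs.
by exists d => // r rd; exact: H.
Qed.

(* Gauge argument: around a good point f decreases at most at rate eta, around a bad one the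
   step is contained in a small open set, so that absolute continuity controls the sum of
   the corresponding increments. *)
Lemma abs_cont_nondecreasing (R : realType) (Z : set R) (f df : R -> R) (a b : R) :
  a <= b -> abs_cont_on f a b -> (@lebesgue_measure R).-negligible Z ->
  (forall t, a <= t <= b -> ~ Z t -> is_derive t 1 f (df t) /\ 0 <= df t) ->
  f a <= f b.
Proof.
move=> ab fac [B [mB B0 ZB]] dfP.
apply/ler_addgt0Pr => e e0.
(* The [+ 1] keeps the denominator positive when a = b. *)
pose eta := e / (2 * (b - a + 1)).
have eta0 : 0 < eta by rewrite divr_gt0//; lra.
have e20 : 0 < e / 2 by rewrite divr_gt0.
have [d d0 H] := abs_cont_on_seq fac e20.
have [|U [oU BU Ud]] := lebesgue_regularity_outer mB _ d0.
  by rewrite [X in (X < _)%E]B0.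
pose mu := @lebesgue_measure R.
have mU : measurable U by exact: measurable_realfun.open_measurable.
have muU : (mu U < d%:E)%E.
  rewrite -(setDUK BU); apply: le_lt_trans Ud.
  apply: le_trans (measureU2 _ _ _) _ => //; first exact: measurableD.
  by rewrite [X in (X + _)%E]B0 add0e.
(* The list records the steps taken around points of Z. They lie in U, so [mu] bounds their total
   length; every other step loses at most [eta] per unit of length. *)
pose P t := exists s : seq (R * R),
  [/\ all (fun p => (a <= p.1) && (p.1 <= p.2) && (p.2 <= t)) s,
    pairwise (fun p q => q.2 <= p.1) s,
    ((\sum_(p <- s) (p.2 - p.1))%:E <= mu (U `&` `[a, t]%classic))%E &
    - eta * (t - a) - \sum_(p <- s) `|f p.2 - f p.1| <= f t - f a].
suff [s [als pws sU]] : P b.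
  have sd : \sum_(p <- s) (p.2 - p.1) < d.
    rewrite -lte_fin; apply: le_lt_trans sU _; apply: le_lt_trans muU.
    by apply: le_measure; rewrite ?inE//; apply: measurableI => //; exact: measurable_itv.
  have sf := H s als pws sd.
  have : eta * (b - a) <= e / 2.
    by rewrite /eta mulrAC ler_pdivrMr; lra.
  lra.
apply: (@segment_ind _ P a b) => //.
  exists [::]; rewrite !big_nil /= set_itv1; split=> //.
  by rewrite !subrr mulr0 subrr.
move=> s sab.
have extend t t' : a <= t -> t <= t' ->
    (- eta * (t' - t) <= f t' - f t \/ `[t, t']%classic `<=` U) -> P t -> P t'.
  move=> at_ tt' + [l [al pl lU lf]].
  have al' : all (fun p => (a <= p.1) && (p.1 <= p.2) && (p.2 <= t')) l.
    by apply: sub_all al => p /andP[-> /= /le_trans]; exact.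
  have mI r r' : measurable (`[r, r']%classic : set R) by exact: measurable_itv.
  case=> [ftt'|ttU].
    exists l; split=> //; last lra.
    apply: le_trans lU _; apply: le_measure; rewrite ?inE; try exact: measurableI.
    apply: setIS => r /=; rewrite !in_itv /= => /andP[-> rt] /=; exact: le_trans tt'.
  exists ((t, t') :: l); split=> /=.
  - by rewrite at_ tt' lexx.
  - rewrite pl andbT; apply: sub_all al => p; by rewrite -andbA => /and3P[].
  - rewrite big_cons /= addrC EFinD.
    (* A half-open interval is disjoint from [[a, t]], which makes the measure additive. *)
    have -> : (t' - t)%:E = mu (`]t, t']%classic : set R).
      rewrite /mu lebesgue_measure_itv /= lte_fin EFinB.
      by case: ltgtP tt' => // <-; rewrite subee.
    apply: le_trans (leeD2r _ lU) _.
    have mI' : measurable (`]t, t']%classic : set R) by exact: measurable_itv.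
    have mUt : measurable (U `&` `[a, t]%classic) by exact: measurableI.
    rewrite -measureU//; last first.
      apply/seteqP; split=> // r /= [[_]]; rewrite !in_itv /= => /andP[_ rt] /andP[tr _].
      lra.
    apply: le_measure; rewrite ?inE//; [exact: measurableU|exact: measurableI|].
    move=> r /= []; rewrite !in_itv /=.
      by case=> Ur /andP[ar rt]; split=> //; rewrite ar; exact: le_trans tt'.
    move=> /andP[tr rt']; split; last by rewrite rt' andbT; lra.
    by apply: ttU; rewrite /= in_itv /= rt' andbT ltW.
  - rewrite big_cons /=; have := ler_norm (- (f t' - f t)); rewrite normrN; 
    have : 0 <= eta * (t' - t) by rewrite mulr_ge0 ?subr_ge0// ltW.
    lra.
have [Zs|nZs] := pselect (Z s).
  have [d1 d10 dU] := open_in_segment oU (BU _ (ZB _ Zs)).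
  exists d1 => // t t' at_ ts ts' st' t's t'b Pt.
  apply: (extend t t' _ _ _ Pt) => //; first lra.
  right=> r /=; rewrite in_itv /= => /andP[tr rt']; apply: dU.
  rewrite ltr_norml; lra.
have [dfs dfs0] := dfP s sab nZs.
have [d1 d10 dU] := derive_ge0_near dfs dfs0 eta0.
exists d1 => // t t' at_ ts ts' st' t's t'b Pt.
apply: (extend t t' _ _ _ Pt) => //; first lra.
left; have [|_ /(_ ts')] := dU t; first by rewrite ltr_norml; lra.
have [|/(_ st') + _] := dU t'; first by rewrite ltr_norml; lra.
lra.
Qed.

Lemma abs_cont_unif (R : realType) (f : R -> R) (a b e : R) :
  abs_cont_on f a b -> 0 < e -> exists2 d, 0 < d &
  forall s r, a <= s <= b -> a <= r <= b -> `|s - r| < d -> `|f s - f r| < e.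
Proof.
move=> fac e0; have [d d0 H] := abs_cont_on_seq fac e0; exists d => //.
have H' s r : a <= s -> s <= r -> r <= b -> r - s < d -> `|f r - f s| < e.
  move=> as_ sr rb srd; have := H [:: (s, r)].
  by rewrite !big_seq1 /= as_ sr rb; apply.
move=> s r /andP[as_ sb] /andP[ar rb].
rewrite ltr_norml => /andP[sr rs]; case: (leP s r) => h.
  by rewrite distrC; apply: H' => //; lra.
by apply: H' => //; lra.
Qed.

Lemma abs_cont_onS (R : realType) (f : R -> R) (a b a' b' : R) :
  a <= a' -> b' <= b -> abs_cont_on f a b -> abs_cont_on f a' b'.
Proof.
move=> aa bb fac e e0; have [d [d0 H]] := fac e e0; exists d; split=> // k l r lr.
by apply: H => i; have [? []] := lr i; split; [|split] => //; lra.
Qed.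

(** A common criterion for sums, products, inverses and exponentials: each is Lipschitz in its
    arguments on the range reached over a bounded segment, with K depending on that segment. *)
Lemma abs_cont_lip (R : realType) (F f g : R -> R) (a b K : R) :
  abs_cont_on f a b -> abs_cont_on g a b ->
  (forall s t, a <= s <= b -> a <= t <= b ->
     `|F s - F t| <= K * (`|f s - f t| + `|g s - g t|)) ->
  abs_cont_on F a b.
Proof.
move=> fac gac FK e e0; pose K1 := `|K| + 1.
have K0 : 0 < K1 by rewrite ltr_pwDr.
have e1 : 0 < e / (2 * K1) by rewrite divr_gt0// mulr_gt0.
have [d [d0 H]] := fac _ e1; have [d' [d'0 H']] := gac _ e1.
exists (Num.min d d'); split; first by rewrite lt_min d0.
move=> k l r lr dis; rewrite lt_min => /andP[/(H _ _ _ lr dis) hf /(H' _ _ _ lr dis) hg].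
apply: (@le_lt_trans _ _
  (K1 * (\sum_(i < k) `|f (r i) - f (l i)| + \sum_(i < k) `|g (r i) - g (l i)|))).
  rewrite -big_split mulr_sumr; apply: ler_sum => i _.
  have [? [? ?]] := lr i; apply: le_trans (FK _ _ _ _) _; try lra.
  apply: ler_wpM2r; first exact: addr_ge0.
  by rewrite /K1 (le_trans (ler_norm _))// lerDl.
have -> : e = K1 * (e / (2 * K1) + e / (2 * K1)) by field; rewrite gt_eqF.
by rewrite ltr_pM2l// ltrD.
Qed.

Lemma abs_cont_bounded (R : realType) (f : R -> R) (a b : R) :
  a <= b -> abs_cont_on f a b -> exists M, forall t, a <= t <= b -> `|f t| <= M.
Proof.
move=> ab fac; have [d d0 H] := abs_cont_unif fac ltr01.
apply: (@segment_ind _ (fun r => exists M, forall t, a <= t <= r -> `|f t| <= M) a b) => //.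
  by exists `|f a| => t; rewrite -eq_le => /eqP ->.
move=> s sab; exists d => // t t' at_ ts ts' st' t's t'b [M HM].
exists (Num.max M (`|f s| + 1)) => r /andP[ar rt']; rewrite le_max.
case: (leP r t) => rt; first by rewrite HM// ar.
apply/orP; right.
have rs : `|r - s| < d by rewrite ltr_norml; lra.
have : `|f r - f s| < 1 by apply: H => //; lra.
have := lerB_dist (f r) (f s); lra.
Qed.

Lemma abs_cont_bounded_below (R : realType) (f : R -> R) (a b : R) :
  a <= b -> abs_cont_on f a b -> (forall t, a <= t <= b -> 0 < f t) ->
  exists2 c, 0 < c & forall t, a <= t <= b -> c <= f t.
Proof.
move=> ab fac f0.
apply: (@segment_ind _ (fun r => exists2 c, 0 < c & forall t, a <= t <= r -> c <= f t)
  a b) => //.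
  exists (f a); first by apply: f0; rewrite lexx.
  by move=> t; rewrite -eq_le => /eqP ->.
move=> s sab; have fs : 0 < f s / 2 by rewrite divr_gt0// f0.
have [d d0 H] := abs_cont_unif fac fs; exists d => // t t' at_ ts ts' st' t's t'b [c c0 Hc].
exists (Num.min c (f s / 2)); first by rewrite lt_min c0.
move=> r /andP[ar rt']; rewrite ge_min.
case: (leP r t) => rt; first by rewrite Hc// ar.
apply/orP; right.
have rs : `|r - s| < d by rewrite ltr_norml; lra.
have : `|f r - f s| < f s / 2 by apply: H => //; lra.
rewrite ltr_norml; lra.
Qed.

Lemma abs_cont_pos (R : realType) (f : R -> R) (a b : R) :
  a <= b -> abs_cont_on f a b -> (forall t, a <= t <= b -> f t != 0) ->
  0 < f a -> 0 < f b.
Proof.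
move=> ab fac f0 fa; apply: (@segment_ind _ (fun t => 0 < f t) a b) => //.
move=> s sab; have fs : 0 < `|f s| by rewrite normr_gt0 f0.
have [d d0 H] := abs_cont_unif fac fs; exists d => // t t' at_ ts ts' st' t's t'b ft.
have ht : `|f t - f s| < `|f s| by apply: H; try lra; rewrite ltr_norml; lra.
have ht' : `|f t' - f s| < `|f s| by apply: H; try lra; rewrite ltr_norml; lra.
move: ht ht'; rewrite !ltr_norml; case: (ger0P (f s)); lra.
Qed.

(** The exceptional set is shared by all functions, so that combining them creates no unions of null
    sets. The values of [df] on Z are arbitrary. *)
Definition acd (R : realType) (Z : set R) (f df : R -> R) : Prop :=
  (forall T, 0 < T -> abs_cont_on f 0 T) /\
  (forall t, 0 <= t -> ~ Z t -> is_derive t 1 f (df t)).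

(** * Calculus and monotonicity for almost everywhere derivatives *)

Section Acd.
Variables (R : realType) (Z : set R).
Implicit Types f g df dg : R -> R.

Lemma acd_ext f df g dg : acd Z f df -> f =1 g ->
  (forall t, 0 <= t -> ~ Z t -> df t = dg t) -> acd Z g dg.
Proof.
move=> [fac fd] /funext fg e; rewrite -fg; split=> // t t0 Zt.
by rewrite -e//; exact: fd.
Qed.

Lemma acd_cst c : acd Z (fun=> c) (fun=> 0).
Proof.
split=> [T T0 e e0|t _ _]; last exact: is_derive_cst.
exists 1; split=> // k l r _ _ _; rewrite big1// => i _; by rewrite subrr normr0.
Qed.

Lemma acd_id : acd Z id (fun=> 1).
Proof.
split=> [T T0 e e0|t _ _]; last exact: is_derive_id.
exists e; split=> // k l r lr _; congr (_ < _); apply: eq_bigr => i _.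
by rewrite ger0_norm// subr_ge0; have [_ []] := lr i.
Qed.

Lemma acdD f df g dg : acd Z f df -> acd Z g dg ->
  acd Z (fun t => f t + g t) (fun t => df t + dg t).
Proof.
move=> [fac fd] [gac gd]; split=> [T T0|t t0 Zt]; last first.
  by apply: is_deriveD; [exact: fd|exact: gd].
apply: (abs_cont_lip (K := 1) (fac T T0) (gac T T0)) => s t _ _; rewrite mul1r.
by rewrite opprD addrACA ler_normD.
Qed.

Lemma acdM f df g dg : acd Z f df -> acd Z g dg ->
  acd Z (fun t => f t * g t) (fun t => df t * g t + f t * dg t).
Proof.
move=> [fac fd] [gac gd]; split=> [T T0|t t0 Zt]; last first.
  rewrite addrC [X in _ + X]mulrC.
  by apply: is_deriveM; [exact: fd|exact: gd].
have [M HM] := abs_cont_bounded (ltW T0) (fac T T0).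
have [N HN] := abs_cont_bounded (ltW T0) (gac T T0).
apply: (abs_cont_lip (K := `|M| + `|N|) (fac T T0) (gac T T0)) => s t hs ht.
have -> : f s * g s - f t * g t = (f s - f t) * g s + f t * (g s - g t) by ring.
apply: le_trans (ler_normD _ _) _; rewrite !normrM.
have h1 : `|g s| <= `|M| + `|N|.
  by apply: le_trans (HN _ hs) _; rewrite (le_trans (ler_norm _))// lerDr.
have h2 : `|f t| <= `|M| + `|N|.
  by apply: le_trans (HM _ ht) _; rewrite (le_trans (ler_norm _))// lerDl.
by rewrite mulrDr; apply: lerD; [rewrite mulrC|]; apply: ler_wpM2r.
Qed.

Lemma acdZ c f df : acd Z f df -> acd Z (fun t => c * f t) (fun t => c * df t).
Proof.
by move=> fd; apply: acd_ext (acdM (acd_cst c) fd) _ _ => //= t _ _; rewrite mul0r add0r.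
Qed.

Lemma acdN f df : acd Z f df -> acd Z (fun t => - f t) (fun t => - df t).
Proof.
by move=> fd; apply: acd_ext (acdZ (-1) fd) _ _ => [t|t _ _]; rewrite mulN1r.
Qed.

Lemma acdB f df g dg : acd Z f df -> acd Z g dg ->
  acd Z (fun t => f t - g t) (fun t => df t - dg t).
Proof. by move=> fd gd; exact: acdD fd (acdN gd). Qed.

Lemma acd_sum (I : Type) (s : seq I) (P : pred I) (f df : I -> R -> R) :
  (forall i, P i -> acd Z (f i) (df i)) ->
  acd Z (fun t => \sum_(i <- s | P i) f i t) (fun t => \sum_(i <- s | P i) df i t).
Proof.
move=> fd; elim: s => [|i s IH].
  by apply: acd_ext (acd_cst 0) _ _ => t; rewrite big_nil.
case Pi : (P i).
  by apply: acd_ext (acdD (fd i Pi) IH) _ _ => t; rewrite big_cons Pi.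
by apply: acd_ext IH _ _ => t; rewrite big_cons Pi.
Qed.

Lemma acdV f df : (forall t, 0 <= t -> 0 < f t) -> acd Z f df ->
  acd Z (fun t => (f t)^-1) (fun t => - (df t / f t ^+ 2)).
Proof.
move=> f0 [fac fd]; split=> [T T0|t t0 Zt]; last first.
  rewrite mulrC -mulNr.
  by apply: is_deriveV; [rewrite gt_eqF// f0|exact: fd].
have [|c c0 Hc] := abs_cont_bounded_below (ltW T0) (fac T T0).
  by move=> t /andP[t0 _]; exact: f0.
apply: (abs_cont_lip (K := c ^-2) (fac T T0) (fac T T0)) => s t hs ht.
have fs := lt_le_trans c0 (Hc s hs); have ft := lt_le_trans c0 (Hc t ht).
have -> : (f s)^-1 - (f t)^-1 = (f s * f t)^-1 * (f t - f s).
  by field; rewrite !gt_eqF.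
rewrite normrM distrC; apply: ler_pM => //; last by rewrite lerDl.
have fst : 0 < f s * f t by rewrite mulr_gt0.
rewrite ger0_norm ?invr_ge0 ?(ltW fst)//.
rewrite lef_pV2 ?posrE ?exprn_gt0//.
by rewrite expr2; apply: ler_pM; rewrite ?(ltW c0)// Hc.
Qed.

Lemma acd_expR f df : acd Z f df ->
  acd Z (fun t => expR (f t)) (fun t => expR (f t) * df t).
Proof.
move=> [fac fd]; split=> [T T0|t t0 Zt]; last first.
  by apply: (@is_derive1_comp _ expR f); exact: fd.
have [M HM] := abs_cont_bounded (ltW T0) (fac T T0).
have expB a b : a <= b -> b <= M -> expR b - expR a <= expR M * (b - a).
  move=> ab bM; have -> : expR a = expR b * expR (a - b) by rewrite -expRD addrC subrK.
  rewrite -[X in X - _]mulr1 -mulrBr ler_pM ?expR_ge0 ?ler_expR//.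
    by rewrite subr_ge0 -expR0 ler_expR; lra.
  have := expR_ge1Dx (a - b); lra.
apply: (abs_cont_lip (K := expR M) (fac T T0) (fac T T0)) => s t hs ht.
have bM r : 0 <= r <= T -> f r <= M by move=> hr; exact: le_trans (ler_norm _) (HM _ hr).
apply: (@le_trans _ _ (expR M * `|f s - f t|)); last first.
  by rewrite ler_wpM2l ?expR_ge0// lerDl.
case: (leP (f s) (f t)) => h.
  by rewrite distrC (distrC (f s)) !ger0_norm ?subr_ge0 ?ler_expR// expB ?bM.
by rewrite !ger0_norm ?subr_ge0 ?ler_expR ?expB ?bM// ltW.
Qed.

Lemma acd_nondecreasing f df a b : (@lebesgue_measure R).-negligible Z ->
  acd Z f df -> 0 <= a -> a <= b ->
  (forall t, a <= t <= b -> ~ Z t -> 0 <= df t) -> f a <= f b.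
Proof.
move=> Z0 [fac fd] a0 ab df0.
have [->//|ab'] := eqVneq a b.
have b0 : 0 < b by apply: le_lt_trans a0 _; rewrite lt_neqAle ab'.
apply: (abs_cont_nondecreasing (df := df) ab _ Z0).
  exact: abs_cont_onS (fac b b0).
move=> t tab Zt; split; last exact: df0.
by apply: fd => //; case/andP: tab => /(le_trans a0).
Qed.

Lemma acd_nonincreasing f df a b : (@lebesgue_measure R).-negligible Z ->
  acd Z f df -> 0 <= a -> a <= b ->
  (forall t, a <= t <= b -> ~ Z t -> df t <= 0) -> f b <= f a.
Proof.
move=> Z0 fd a0 ab df0; rewrite -lerN2.
apply: (acd_nondecreasing Z0 (acdN fd)) => // t tab Zt; by rewrite oppr_ge0 df0.
Qed.

Lemma acd_constant f df a b : (@lebesgue_measure R).-negligible Z ->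
  acd Z f df -> 0 <= a -> a <= b ->
  (forall t, a <= t <= b -> ~ Z t -> df t = 0) -> f b = f a.
Proof.
move=> Z0 fd a0 ab df0; apply/eqP; rewrite eq_le.
rewrite (acd_nonincreasing Z0 fd)// ?(acd_nondecreasing Z0 fd)// => t tab Zt;
  by rewrite df0.
Qed.

End Acd.

(** * Euclidean inner product *)

Section Dotc.
Variables (R : realType) (m : nat).
Implicit Types u v w : 'cV[R]_m.

Lemma dotcC u v : dotc u v = dotc v u.
Proof. by apply: eq_bigr => k _; rewrite mulrC. Qed.

Lemma dotcDr u v w : dotc u (v + w) = dotc u v + dotc u w.
Proof. by rewrite -big_split; apply: eq_bigr => k _; rewrite mxE mulrDr. Qed.

Lemma dotcZr c u v : dotc u (c *: v) = c * dotc u v.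
Proof. by rewrite mulr_sumr; apply: eq_bigr => k _; rewrite mxE mulrCA. Qed.

Lemma dotcDl u v w : dotc (u + v) w = dotc u w + dotc v w.
Proof. by rewrite !(dotcC _ w) dotcDr. Qed.

Lemma dotcZl c u v : dotc (c *: u) v = c * dotc u v.
Proof. by rewrite !(dotcC _ v) dotcZr. Qed.

Lemma dotcNr u v : dotc u (- v) = - dotc u v.
Proof. by rewrite -scaleN1r dotcZr mulN1r. Qed.

Lemma dotcNl u v : dotc (- u) v = - dotc u v.
Proof. by rewrite !(dotcC _ v) dotcNr. Qed.

Lemma dotcBr u v w : dotc u (v - w) = dotc u v - dotc u w.
Proof. by rewrite dotcDr dotcNr. Qed.

Lemma dotcBl u v w : dotc (u - v) w = dotc u w - dotc v w.
Proof. by rewrite dotcDl dotcNl. Qed.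

Lemma dotc0r u : dotc u 0 = 0.
Proof. by rewrite -(scale0r 0) dotcZr mul0r. Qed.

Lemma dotc0l u : dotc 0 u = 0.
Proof. by rewrite dotcC dotc0r. Qed.

Lemma dotc_sumr (I : Type) (s : seq I) (P : pred I) (F : I -> 'cV[R]_m) u :
  dotc u (\sum_(i <- s | P i) F i) = \sum_(i <- s | P i) dotc u (F i).
Proof. by apply: (big_morph (dotc u)); [exact: dotcDr|exact: dotc0r]. Qed.

Lemma dotc_suml (I : Type) (s : seq I) (P : pred I) (F : I -> 'cV[R]_m) u :
  dotc (\sum_(i <- s | P i) F i) u = \sum_(i <- s | P i) dotc (F i) u.
Proof. by rewrite dotcC dotc_sumr; apply: eq_bigr => i _; rewrite dotcC. Qed.

Lemma dotc_ge0 u : 0 <= dotc u u.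
Proof. by apply: sumr_ge0 => k _; rewrite -expr2 sqr_ge0. Qed.

Lemma dotc_eq0 u : (dotc u u == 0) = (u == 0).
Proof.
apply/eqP/eqP => [u0|->]; last by rewrite dotc0l.
apply/matrixP => k l; rewrite ord1 mxE; apply/eqP; rewrite -sqrf_eq0 expr2.
by have /psumr_eq0P : forall i : 'I_m, true -> 0 <= u i 0 * u i 0;
  [move=> i _; rewrite -expr2 sqr_ge0|move=> -> //].
Qed.

Lemma enorm_ge0 u : 0 <= enorm u.
Proof. exact: sqrtr_ge0. Qed.

Lemma sqr_enorm u : enorm u ^+ 2 = dotc u u.
Proof. by rewrite sqr_sqrtr// dotc_ge0. Qed.

Lemma enorm_gt0 u : (0 < enorm u) = (u != 0).
Proof. by rewrite sqrtr_gt0 lt_neqAle dotc_ge0 andbT eq_sym dotc_eq0. Qed.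

Lemma enormZ c u : enorm (c *: u) = `|c| * enorm u.
Proof.
by rewrite /enorm dotcZl dotcZr mulrA -expr2 sqrtrM ?sqr_ge0// sqrtr_sqr.
Qed.

Lemma enormN u : enorm (- u) = enorm u.
Proof. by rewrite -scaleN1r enormZ normrN1 mul1r. Qed.

Lemma dotc_le u v : dotc u v <= enorm u * enorm v.
Proof.
have [->|u0] := eqVneq u 0; first by rewrite dotc0l mulr_ge0 ?enorm_ge0.
have [->|v0] := eqVneq v 0; first by rewrite dotc0r mulr_ge0 ?enorm_ge0.
have uv0 : 0 < enorm u * enorm v by rewrite mulr_gt0 ?enorm_gt0.
have := dotc_ge0 (enorm v *: u - enorm u *: v).
rewrite dotcBl !dotcBr !dotcZl !dotcZr -!sqr_enorm (dotcC v u) => h.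
have : 0 <= (enorm u * enorm v) * (enorm u * enorm v - dotc u v) by lra.
by rewrite pmulr_rge0// subr_ge0.
Qed.

Lemma dotc_norm_le u v : `|dotc u v| <= enorm u * enorm v.
Proof. by rewrite ler_norml dotc_le andbT lerNl -dotcNl -(enormN u) dotc_le. Qed.

Lemma enorm_coord u k : `|u k 0| <= enorm u.
Proof.
rewrite -sqrtr_sqr ler_wsqrtr// /dotc (bigD1 k)//= expr2 lerDl.
by apply: sumr_ge0 => i _; rewrite -expr2 sqr_ge0.
Qed.

End Dotc.

Lemma acd_dotc (R : realType) (Z : set R) m (f df g dg : R -> 'cV[R]_m) :
  (forall k, acd Z (fun t => f t k 0) (fun t => df t k 0)) ->
  (forall k, acd Z (fun t => g t k 0) (fun t => dg t k 0)) ->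
  acd Z (fun t => dotc (f t) (g t)) (fun t => dotc (df t) (g t) + dotc (f t) (dg t)).
Proof.
move=> fd gd; apply: acd_ext (acd_sum _ (fun k _ => acdM (fd k) (gd k))) _ _ => // t _ _.
by rewrite big_split.
Qed.

Lemma acd_dotcl (R : realType) (Z : set R) m (f df : R -> 'cV[R]_m) (d : 'cV[R]_m) :
  (forall k, acd Z (fun t => f t k 0) (fun t => df t k 0)) ->
  acd Z (fun t => dotc (f t) d) (fun t => dotc (df t) d).
Proof.
move=> fd; apply: acd_ext (acd_dotc (g := fun=> d) (dg := fun=> 0) fd _) _ _ => //=.
  move=> k; apply: acd_ext (acd_cst _ (d k 0)) _ _ => // t _ _; by rewrite mxE.
by move=> t _ _; rewrite dotc0r addr0.
Qed.

(** * Loss functions *)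

(** Mean value theorem plus continuity of the derivative. Both ends of the increment vary because
    the base point also moves in Clarke's difference quotients. *)
Lemma strict_derivative (R : realType) (f df : R -> R) (p : R) :
  (forall r : R, is_derive r 1 f (df r)) -> {for p, continuous df} ->
  forall eta, 0 < eta -> exists2 d, 0 < d & forall a b, `|a - p| < d -> `|b - p| < d ->
    `|f b - f a - df p * (b - a)| <= eta * `|b - a|.
Proof.
move=> fd dfc eta eta0.
have /cvgr_dist_lt/(_ _ eta0)/nbhs_ballP[d /= d0 H] := dfc.
exists d => //.
have main a b : a < b -> `|a - p| < d -> `|b - p| < d ->
    `|f b - f a - df p * (b - a)| <= eta * `|b - a|.
  move=> ab ad bd; have [|c cab ->] := @MVT _ f df a b ab (fun r _ => fd r).
    by apply: continuous_subspaceT => s; apply: differentiable_continuous;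
      apply/derivable1_diffP; have [] := fd s.
  rewrite -mulrBl normrM ler_wpM2r// ltW// distrC; apply: H.
  rewrite /ball /= distrC; move: cab ad bd; rewrite in_itv /= !ltr_norml; lra.
move=> a b ad bd; case: (ltgtP a b) => [ab|ab|->]; first exact: main.
  have := main b a ab bd ad; rewrite -normrN (distrC a b); congr (`|_| <= _); ring.
by rewrite !subrr mulr0 subrr normr0 mulr0.
Qed.

(** Minus the derivative of the loss with respect to the margin m = y * yhat, that is, the weight
    with which a sample drives the flow. *)
Definition loss_slope (R : realType) (lk : loss_kind) (m : R) : R :=
  match lk with
  | ExpLoss => expR (- m)
  | LogisticLoss => 2 * expR (- m) / (1 + expR (- m))
  end.

Section LossSlope.
Variables (R : realType) (lk : loss_kind).
Implicit Types m y p B : R.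

Lemma loss_slope_gt0 m : 0 < loss_slope lk m.
Proof.
have e0 := expR_gt0 (- m).
by case: lk => //=; rewrite divr_gt0 ?mulr_gt0// addr_gt0.
Qed.

Lemma loss_slope_le m : loss_slope lk m <= 2 * expR (- m).
Proof.
have e0 := expR_gt0 (- m).
case: lk => /=; first lra.
rewrite ler_pdivrMr ?addr_gt0// mulrDr mulr1 lerDl; exact: ltW (mulr_gt0 (mulr_gt0 _ _) _).
Qed.

(** The logistic slope stays below 2, so it is comparable to [expR (- m)] only as long as the margin
    is bounded below. *)
Lemma loss_slope_ge B : exists2 c, 0 < c & forall m, - B <= m -> c * expR (- m) <= loss_slope lk m.
Proof.
have eB := expR_gt0 B.
exists (1 + expR B)^-1 => [|m Bm]; first by rewrite invr_gt0 addr_gt0.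
have e0 := expR_gt0 (- m).
case: lk => /=.
  by rewrite ler_piMl ?(ltW e0)// invf_le1 ?addr_gt0//; lra.
have B0 : 0 < 1 + expR B by rewrite addr_gt0.
rewrite mulrC; apply: ler_pM; rewrite ?invr_ge0 ?(ltW e0) ?(ltW B0)//; first lra.
by rewrite lef_pV2 ?posrE ?addr_gt0// lerD2l ler_expR; lra.
Qed.

Lemma loss_slope_nonincreasing m1 m2 : m1 <= m2 -> loss_slope lk m2 <= loss_slope lk m1.
Proof.
move=> m12; have e1 := expR_gt0 (- m1); have e2 := expR_gt0 (- m2).
have e12 : expR (- m2) <= expR (- m1) by rewrite ler_expR lerN2.
case: lk => //=.
rewrite ler_pdivrMr ?addr_gt0// mulrAC ler_pdivlMr ?addr_gt0//.
lra.
Qed.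

Lemma is_derive_ell y p :
  is_derive p 1 (ell lk y) (- (y * loss_slope lk (y * p))).
Proof.
have lin : is_derive p 1 (fun z => - (y * z)) (- y).
  apply: is_deriveN; rewrite -[X in is_derive _ _ _ X]mulr1.
  exact: (@is_deriveZ _ _ _ id y p 1 1).
have e0 := expR_gt0 (- (y * p)).
have expd : is_derive p 1 (fun z => expR (- (y * z))) (expR (- (y * p)) * - y).
  exact: (@is_derive1_comp _ expR).
case: lk => /=; first by rewrite mulrC -mulrN.
have lnd : is_derive p 1 (fun z => ln (1 + expR (- (y * z))))
   ((1 + expR (- (y * p)))^-1 * (expR (- (y * p)) * - y)).
  apply: (@is_derive1_comp _ (@ln R) (fun z => 1 + expR (- (y * z)))).
    by apply: is_derive1_ln; rewrite addr_gt0.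
  rewrite -[X in is_derive _ _ _ X]add0r.
  by apply: is_deriveD; exact: is_derive_cst.
have := @is_deriveZ _ _ _ _ 2 p 1 _ lnd.
congr is_derive; rewrite /GRing.scale /=; field.
by rewrite gt_eqF// addr_gt0.
Qed.

Lemma continuous_ell_slope y p : {for p, continuous (fun z => - (y * loss_slope lk (y * z)))}.
Proof.
have lin : {for p, continuous (fun z : R => - (y * z))}.
  by apply: continuousN; apply: continuousM => //; exact: cvg_cst.
have ec : {for p, continuous (fun z : R => expR (- (y * z)))}.
  by apply: (@continuous_comp _ _ _ _ expR) => //; exact: continuous_expR.
have e0 := expR_gt0 (- (y * p)).
apply: continuousN; apply: continuousM; first exact: cvg_cst.
case: lk => //=; apply: continuousM; first by apply: continuousM => //; exact: cvg_cst.
apply: continuousV; first by rewrite gt_eqF// addr_gt0.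
by apply: continuousD => //; exact: cvg_cst.
Qed.

End LossSlope.

(** * Clarke subgradients of the loss *)

Lemma cvg_rsum (R : realType) (T I : Type) (F : set_system T) (FF : Filter F)
  (s : seq I) (P : pred I) (f : I -> T -> R) (l : I -> R) :
  (forall i, P i -> f i t @[t --> F] --> l i) ->
  \sum_(i <- s | P i) f i t @[t --> F] --> \sum_(i <- s | P i) l i.
Proof.
move=> fl; elim: s => [|i s IH].
  by under eq_fun do rewrite big_nil; rewrite big_nil; exact: cvg_cst.
under eq_fun do rewrite big_cons; rewrite big_cons; case: ifP => // Pi.
by apply: cvgD; [exact: fl|exact: IH].
Qed.

Lemma relu_lip (R : realType) (a b : R) : `|relu a - relu b| <= `|a - b|.
Proof.
have h1 := ler_norm (a - b); have h2 := ler_norm (- (a - b)); rewrite normrN in h2.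
rewrite /relu /Num.max; case: ltP => ha; case: ltP => hb; rewrite ?subrr ?normr0//;
  by rewrite ler_norml; lra.
Qed.

Lemma relu_ge0 (R : realType) (a : R) : 0 <= relu a.
Proof. by rewrite /relu le_max lexx orbT. Qed.

Lemma relu_pos (R : realType) (a : R) : 0 <= a -> relu a = a.
Proof. by move=> a0; rewrite /relu max_l. Qed.

Lemma relu_neg (R : realType) (a : R) : a <= 0 -> relu a = 0.
Proof. by move=> a0; rewrite /relu max_r. Qed.

Lemma cvg_relu (R : realType) (T : Type) (F : set_system T) (FF : Filter F)
  (f : T -> R) (l : R) : f @ F --> l -> relu (f t) @[t --> F] --> relu l.
Proof.
move=> /cvgrPdist_lt fl; apply/cvgrPdist_lt => e /fl; apply: filterS => t.
exact/le_lt_trans/relu_lip.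
Qed.

(** The least value of s * k when s ranges over the subdifferential of [relu] at z, which is the
    whole segment [0, 1] at z = 0. *)
Definition act_low (R : realType) (k z : R) : R :=
  if 0 < z then k else if z == 0 then Num.min k 0 else 0.

(** Away from the kink the second hypothesis forces both arguments of [relu] to have the sign of z,
    and the quotient is exactly [z'] or 0. At the kink the worst slope between 0 and 1 is charged.
    The last term pays for replacing [Vq] by [V]. *)
Lemma act_low_relu_quotient (R : realType) (c V z z' Vq zq tau : R) :
  0 < tau -> (z != 0 -> `|zq - z| + tau * `|z'| < `|z|) ->
  c * (Vq * ((relu (zq + tau * z') - relu zq) / tau))
    <= - act_low (- (c * V * z')) z + `|c| * `|z'| * `|Vq - V|.
Proof.
move=> t0 zz; set r := (_ / tau).
have rz : `|r| <= `|z'|.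
  rewrite normrM normfV (gtr0_norm t0) ler_pdivrMr// (le_trans (relu_lip _ _))//.
  by rewrite addrAC subrr add0r normrM mulrC (gtr0_norm t0).
have -> : c * (Vq * r) = c * V * r + c * (Vq - V) * r by ring.
have tz := ler_norm (tau * z'); have tz' := ler_norm (- (tau * z')).
rewrite normrN in tz'; rewrite normrM (gtr0_norm t0) in tz tz'.
have h1 := ler_norm (zq - z); have h2 := ler_norm (- (zq - z)); rewrite normrN in h2.
apply: lerD; last first.
  rewrite (le_trans (ler_norm _))// (normrM _ r) (normrM c) mulrAC ler_wpM2r//.
  by rewrite ler_wpM2l.
rewrite /act_low; case: (ltgtP z 0) => [zn|zp|z00].
- have := zz (ltr0_neq0 zn); rewrite (ltr0_norm zn) => hz.
  by rewrite /r !relu_neg ?subrr ?mul0r ?mulr0 ?oppr0//; lra.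
- have := zz (lt0r_neq0 zp); rewrite (gtr0_norm zp) => hz.
  rewrite /r !relu_pos; try lra.
  by rewrite opprK (addrC zq) addrK (mulrC tau) mulfK ?gt_eqF.
(* The quotient lies between 0 and [z']; these two products say so for both signs of [z']. *)
- have rr : 0 <= r * z' /\ r * (r - z') <= 0.
    have : r = z' \/ r = 0 \/ (z' <= r /\ r <= 0) \/ (0 <= r /\ r <= z').
      have rE : tau * r = relu (zq + tau * z') - relu zq.
        by rewrite /r mulrC divfK ?gt_eqF.
      case: (leP 0 (zq + tau * z')) => ha; case: (leP 0 zq) => hb.
      + left; apply: (mulfI (lt0r_neq0 t0)); rewrite rE !relu_pos//; ring.
      + right; right; right; rewrite relu_pos// [relu zq]relu_neg ?(ltW hb)// in rE.
        by split; rewrite -(ler_pM2l t0) rE; lra.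
      + right; right; left; rewrite relu_neg ?(ltW ha)// [relu zq]relu_pos// in rE.
        by split; rewrite -(ler_pM2l t0) rE; lra.
      + right; left; apply: (mulfI (lt0r_neq0 t0)).
        by rewrite rE !relu_neg ?(ltW ha) ?(ltW hb)// subrr mulr0.
    case=> [->|[->|[[h3 h4]|[h3 h4]]]].
    - by rewrite subrr mulr0 -expr2 sqr_ge0.
    - by rewrite !mul0r.
    - by split; [rewrite mulr_le0//; lra|rewrite mulr_le0_ge0//; lra].
    - by split; [rewrite mulr_ge0//; lra|rewrite mulr_ge0_le0//; lra].
  rewrite oppr_min oppr0 opprK le_max; case: rr => h3 h4.
  case: (leP (c * V * r) 0) => h5; first by rewrite orbT.
  rewrite orbF.
  have [r0|r0] := eqVneq r 0; first by move: h5; rewrite r0 mulr0 ltxx.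
  have [rp|rn|r00] := ltgtP 0 r; last by rewrite -r00 eqxx in r0.
    rewrite ler_wpM2l//; first by rewrite -(pmulr_lge0 _ rp) ltW.
    by move: h4; rewrite pmulr_rle0// subr_le0.
  rewrite ler_wnM2l//; first by rewrite -(nmulr_lge0 _ rn) ltW.
  by move: h4; rewrite nmulr_rle0// subr_ge0.
Qed.

Lemma frob_coord (R : realType) m n (A : 'M[R]_(m, n)) i j : `|A i j| <= frob A.
Proof.
rewrite -sqrtr_sqr ler_wsqrtr// /frob_dot (bigD1 i)//= (bigD1 j)//= -addrA expr2 lerDl.
by rewrite addr_ge0//; repeat (apply: sumr_ge0 => ? _); rewrite -expr2 sqr_ge0.
Qed.

Section ClarkeFilter.
Variables (R : realType) (m n : nat) (p : 'M[R]_(m, n)).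

(** Base points tending to p together with positive step lengths tending to 0: Clarke's limsup
    becomes a limsup along a filter, to which the usual limit rules apply. *)
Definition clarke_filter : set_system ('M[R]_(m, n) * R) :=
  filter_from [set d : R | 0 < d]
    (fun d => [set qt | frob (qt.1 - p) < d /\ 0 < qt.2 < d]).

Global Instance clarke_filter_filter : Filter clarke_filter.
Proof.
apply: filter_from_filter; first by exists 1 => /=.
move=> d e /= d0 e0; exists (Num.min d e) => /=; first by rewrite lt_min d0.
by move=> qt /= [+ /andP[t0]]; rewrite !lt_min => /andP[-> ->] /andP[-> ->]; rewrite t0.
Qed.

Lemma clarke_filter_gt0 : \forall qt \near clarke_filter, 0 < qt.2.
Proof. by exists 1 => //= qt [_ /andP[]]. Qed.

Lemma cvg_clarke_filter2 : qt.2 @[qt --> clarke_filter] --> 0.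
Proof.
apply/cvgrPdist_lt => e e0; exists e => //= qt [_ /andP[t0 te]].
by rewrite sub0r normrN gtr0_norm.
Qed.

Lemma cvg_clarke_filter_coord i j : (qt.1 : 'M[R]_(m, n)) i j @[qt --> clarke_filter] --> p i j.
Proof.
apply/cvgrPdist_lt => e e0; exists e => //= qt [qp _]; rewrite distrC.
by apply: le_lt_trans qp; have := frob_coord (qt.1 - p) i j; rewrite !mxE.
Qed.

Lemma clarke_subdiff_near (F : 'M[R]_(m, n) -> R) (xi v : 'M[R]_(m, n)) (U : R) :
  clarke_subdiff F p xi ->
  (forall eta, 0 < eta -> \forall qt \near clarke_filter,
     (F (qt.1 + qt.2 *: v) - F qt.1) / qt.2 <= U + eta) ->
  frob_dot xi v <= U.
Proof.
move=> Fxi FU; apply/ler_addgt0Pr => e e0.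
have e20 : 0 < e / 2 by rewrite divr_gt0.
have [d /= d0 H] := FU _ e20.
have [q [t [qp [td lt]]]] := Fxi v d (e / 2) d0 e20.
have /= := H (q, t) (conj qp td); lra.
Qed.

End ClarkeFilter.

Section LossQuotient.
Variables (R : realType) (n D h : nat) (x : 'I_n -> 'cV[R]_D) (y : 'I_n -> R) (lk : loss_kind).
Variables (p v : 'M[R]_(1 + D, h)).

Let pre (th : 'M[R]_(1 + D, h)) i j := dotc (col j (Wpart th)) (x i).
Let c i := - (y i * loss_slope lk (y i * net p (x i))).
Local Notation F := (clarke_filter p).

Let preD q t i j : pre (q + t *: v) i j = pre q i j + t * pre v i j.
Proof.
rewrite /pre -dotcZl -dotcDl; congr dotc; apply/matrixP => k l.
by rewrite !mxE.
Qed.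

Let VpartD q t j : Vpart (q + t *: v) 0 j = Vpart q 0 j + t * Vpart v 0 j.
Proof. by rewrite !mxE. Qed.

(** Discrete product rule: the increment of the output weight meets the new activation, the
    increment of the activation meets the old output weight. *)
Let quot i j (qt : 'M[R]_(1 + D, h) * R) :=
  Vpart v 0 j * relu (pre qt.1 i j + qt.2 * pre v i j) +
  Vpart qt.1 0 j * ((relu (pre qt.1 i j + qt.2 * pre v i j) - relu (pre qt.1 i j)) / qt.2).

Let net_diff i q t : 0 < t ->
  net (q + t *: v) (x i) - net q (x i) = t * \sum_j quot i j (q, t).
Proof.
move=> t0; rewrite -sumrB mulr_sumr; apply: eq_bigr => j _.
rewrite VpartD /quot /= -[dotc (col j (Wpart (q + _))) _]/(pre (q + t *: v) i j) preD.
by rewrite -[dotc _ _]/(pre q i j); field; rewrite gt_eqF.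
Qed.

Let cvg_pre i j : pre qt.1 i j @[qt --> F] --> pre p i j.
Proof.
apply: cvg_rsum => k _; apply: cvgM; last exact: cvg_cst.
under eq_fun do rewrite !mxE; rewrite !mxE; exact: cvg_clarke_filter_coord.
Qed.

Let cvg_Vpart j : Vpart qt.1 0 j @[qt --> F] --> Vpart p 0 j.
Proof. under eq_fun do rewrite !mxE; rewrite !mxE; exact: cvg_clarke_filter_coord. Qed.

Let cvg_preD i j : pre qt.1 i j + qt.2 * pre v i j @[qt --> F] --> pre p i j.
Proof.
rewrite -[X in _ --> X]addr0; apply: cvgD; first exact: cvg_pre.
rewrite -(mul0r (pre v i j)); apply: cvgM; [exact: cvg_clarke_filter2|exact: cvg_cst].
Qed.

(** The first part is an honest limit; the second is only an upper bound for the limsup, attributed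
    neuron by neuron and sample by sample. Subadditivity of the limsup allows these bounds to be
    summed. *)
Let B i j := c i * Vpart v 0 j * relu (pre p i j)
  - act_low (- (c i * Vpart p 0 j * pre v i j)) (pre p i j).

Let quot_le i j eta : 0 < eta -> \forall qt \near F, c i * quot i j qt <= B i j + eta.
Proof.
move=> eta0.
have h1 : c i * Vpart v 0 j * relu (pre qt.1 i j + qt.2 * pre v i j) @[qt --> F] -->
    c i * Vpart v 0 j * relu (pre p i j).
  by apply: cvgM; [exact: cvg_cst|apply: cvg_relu; exact: cvg_preD].
have h2 : `|c i| * `|pre v i j| * `|Vpart qt.1 0 j - Vpart p 0 j| @[qt --> F] --> 0.
  rewrite -[X in _ --> X](mulr0 (`|c i| * `|pre v i j|)).
  apply: cvgM; first exact: cvg_cst.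
  rewrite -(normr0 R) -(subrr (Vpart p 0 j)); apply: cvg_norm.
  by apply: cvgB; [exact: cvg_Vpart|exact: cvg_cst].
have h3 : `|pre qt.1 i j - pre p i j| + qt.2 * `|pre v i j| @[qt --> F] --> 0.
  rewrite -[X in _ --> X]addr0; apply: cvgD.
    rewrite -(normr0 R) -(subrr (pre p i j)); apply: cvg_norm.
    by apply: cvgB; [exact: cvg_pre|exact: cvg_cst].
  rewrite -(mul0r `|pre v i j|); apply: cvgM; [exact: cvg_clarke_filter2|exact: cvg_cst].
have h3' : \forall qt \near F, pre p i j != 0 ->
    `|pre qt.1 i j - pre p i j| + qt.2 * `|pre v i j| < `|pre p i j|.
  have [->|p0] := eqVneq (pre p i j) 0; first exact: nearW.
  have p0' : 0 < `|pre p i j| by rewrite normr_gt0.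
  by apply: filterS (cvgr_lt _ h3 _ p0') => qt.
have e2 : 0 < eta / 2 by rewrite divr_gt0.
have h1' : \forall qt \near F, c i * Vpart v 0 j * relu (pre qt.1 i j + qt.2 * pre v i j)
    < c i * Vpart v 0 j * relu (pre p i j) + eta / 2.
  by apply: cvgr_lt h1 _ _; rewrite ltrDl.
have h2' : \forall qt \near F,
    `|c i| * `|pre v i j| * `|Vpart qt.1 0 j - Vpart p 0 j| < eta / 2.
  exact: cvgr_lt h2 _ e2.
have h4 := clarke_filter_gt0 p.
have h34 : \forall qt \near F, 0 < qt.2 /\ (pre p i j != 0 ->
    `|pre qt.1 i j - pre p i j| + qt.2 * `|pre v i j| < `|pre p i j|).
  exact: filterI h4 h3'.
apply: filterS3 h1' h2' h34 => qt /= k1 k2 [k4 k3].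
have := act_low_relu_quotient (c i) (Vpart p 0 j) (Vpart qt.1 0 j) k4 k3.
rewrite /quot /B mulrDr mulrA; lra.
Qed.

Let quot_bounded i j : exists M : R, \forall qt \near F, `|quot i j qt| <= M.
Proof.
pose M1 := `|Vpart v 0 j * relu (pre p i j)| + 1.
pose M2 := `|Vpart p 0 j| + 1.
exists (M1 + M2 * `|pre v i j|).
have h1 : Vpart v 0 j * relu (pre qt.1 i j + qt.2 * pre v i j) @[qt --> F] -->
    Vpart v 0 j * relu (pre p i j).
  by apply: cvgM; [exact: cvg_cst|apply: cvg_relu; exact: cvg_preD].
have h1' : \forall qt \near F,
    `|Vpart v 0 j * relu (pre qt.1 i j + qt.2 * pre v i j)| <= M1.
  by apply: cvgr_norm_le h1 _ _; rewrite ltrDl.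
have h2' : \forall qt \near F, `|Vpart qt.1 0 j| <= M2.
  by apply: cvgr_norm_le (@cvg_Vpart j) _ _; rewrite ltrDl.
apply: filterS3 h1' h2' (clarke_filter_gt0 p) => qt /= k1 k2 k3.
rewrite /quot (le_trans (ler_normD _ _))// lerD// normrM ler_pM//.
rewrite normrM normfV (gtr0_norm k3) ler_pdivrMr// (le_trans (relu_lip _ _))//.
by rewrite addrAC subrr add0r normrM mulrC (gtr0_norm k3).
Qed.

Let cvg_net i : net qt.1 (x i) @[qt --> F] --> net p (x i).
Proof.
by apply: cvg_rsum => j _; apply: cvgM; [exact: cvg_Vpart|apply: cvg_relu; exact: cvg_pre].
Qed.

Let loss_quot_le i eta : 0 < eta -> \forall qt \near F,
  (ell lk (y i) (net (qt.1 + qt.2 *: v) (x i)) - ell lk (y i) (net qt.1 (x i))) / qt.2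
    <= \sum_j B i j + eta.
Proof.
move=> eta0.
have [M HM] := choice (quot_bounded i).
pose S := \sum_j `|M j|.
have S0 : 0 <= S by apply: sumr_ge0.
have qb : \forall qt \near F, forall j, `|quot i j qt| <= M j by exact: filter_forall.
have sb : \forall qt \near F, `|\sum_j quot i j qt| <= S.
  apply: filterS qb => qt k; apply: le_trans (ler_norm_sum _ _ _) _.
  by apply: ler_sum => j _; apply: le_trans (k j) (ler_norm _).
(* Half of [eta] is shared among the neurons; the other half pays for linearising [ell] over an
   increment of size at most t * S. *)
have e1 : 0 < eta / (2 * (h%:R + 1)) by rewrite divr_gt0// mulr_gt0// ltr_pwDr.
have ql : \forall qt \near F, forall j, c i * quot i j qt <= B i j + eta / (2 * (h%:R + 1)).
  by apply: filter_forall => j; exact: quot_le.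
have e2 : 0 < eta / (2 * (S + 1)) by rewrite divr_gt0// mulr_gt0// ltr_pwDr.
have [d d0 H] := strict_derivative (is_derive_ell lk (y i))
  (@continuous_ell_slope _ lk (y i) (net p (x i))) e2.
have d20 : 0 < d / 2 by rewrite divr_gt0.
have n1 : \forall qt \near F, `|net qt.1 (x i) - net p (x i)| < d / 2.
  by have /cvgrPdistC_lt := @cvg_net i; apply.
have n2 : \forall qt \near F, qt.2 * S < d / 2.
  have k : qt.2 * S @[qt --> F] --> 0 * S.
    by apply: cvgM; [exact: cvg_clarke_filter2|exact: cvg_cst].
  by apply: cvgr_lt k _ _; rewrite mul0r.
have n3 := clarke_filter_gt0 p.
have n23 : \forall qt \near F, qt.2 * S < d / 2 /\ 0 < qt.2 by apply: filterI.
have bl : \forall qt \near F, `|\sum_j quot i j qt| <= S /\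
    forall j, c i * quot i j qt <= B i j + eta / (2 * (h%:R + 1)) by apply: filterI.
apply: filterS3 n1 n23 bl => -[q t] /= k1 [k2 t0] [k3 k4].
have nd := net_diff i q t0; set Q := \sum_j quot i j (q, t) in nd k3 *.
have tQ : `|t * Q| <= t * S by rewrite normrM (gtr0_norm t0) ler_pM2l.
have k1' : `|net q (x i) - net p (x i)| < d by apply: lt_trans k1 _; lra.
have k2' : `|net (q + t *: v) (x i) - net p (x i)| < d.
  have -> : net (q + t *: v) (x i) = net q (x i) + t * Q by rewrite -nd [RHS]addrC subrK.
  rewrite addrAC (le_lt_trans (ler_normD _ _))//; lra.
have := H _ _ k1' k2'; rewrite nd.
move=> /(le_trans (ler_norm _)) k5.
have k6 : eta / (2 * (S + 1)) * `|t * Q| <= t * (eta / 2).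
  apply: le_trans (ler_wpM2l (ltW e2) tQ) _.
  rewrite mulrCA ler_pM2l// mulrAC ler_pdivrMr; last by rewrite mulr_gt0// ltr_pwDr.
  lra.
have k7 : c i * Q <= \sum_j B i j + eta / 2.
  rewrite /Q mulr_sumr; apply: le_trans (ler_sum _ (fun j _ => k4 j)) _.
  rewrite big_split /= lerD2l sumr_const card_ord -[X in X <= _]mulr_natl.
  rewrite mulrA ler_pdivrMr; last by rewrite mulr_gt0// ltr_pwDr.
  lra.
have k8 : t * (c i * Q) <= t * (\sum_j B i j + eta / 2) by rewrite ler_pM2l.
rewrite ler_pdivrMr//; move: k5; rewrite -/(c i); lra.
Qed.

Lemma loss_quotient_le eta : 0 < eta -> \forall qt \near clarke_filter p,
  (Loss lk x y (qt.1 + qt.2 *: v) - Loss lk x y qt.1) / qt.2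
    <= \sum_i \sum_j B i j + eta.
Proof.
move=> eta0.
have e1 : 0 < eta / (n%:R + 1) by rewrite divr_gt0// ltr_pwDr.
have : \forall qt \near F, forall i,
    (ell lk (y i) (net (qt.1 + qt.2 *: v) (x i)) - ell lk (y i) (net qt.1 (x i))) / qt.2
    <= \sum_j B i j + eta / (n%:R + 1).
  by apply: filter_forall => i; exact: loss_quot_le.
apply: filterS => qt k.
rewrite /Loss -sumrB mulr_suml; apply: le_trans (ler_sum _ (fun i _ => k i)) _.
rewrite big_split /= lerD2l sumr_const card_ord -[X in X <= _]mulr_natl.
rewrite mulrA ler_pdivrMr; last by rewrite ltr_pwDr.
lra.
Qed.

End LossQuotient.

(* For a flow whose neurons are (v j, w j), with [Z] the null set of exceptional times; the
   last two clauses are what the Clarke inclusion says about a single neuron. *)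
Definition relu_flow (R : realType) n D h (x : 'I_n -> 'cV[R]_D) (y : 'I_n -> R)
    (lk : loss_kind) (Z : set R) (v dv : 'I_h -> R -> R) (w dw : 'I_h -> R -> 'cV[R]_D) :=
  let slope i t :=
    loss_slope lk (y i * \sum_j v j t * relu (dotc (w j t) (x i))) in
  [/\ (@lebesgue_measure R).-negligible Z,
    forall j, acd Z (v j) (dv j),
    forall j k, acd Z (fun t => w j t k 0) (fun t => dw j t k 0),
    forall j t, 0 <= t -> ~ Z t ->
      dv j t = \sum_i y i * slope i t * relu (dotc (w j t) (x i)) &
    forall j t d, 0 <= t -> ~ Z t ->
      \sum_i act_low (y i * slope i t * v j t * dotc (x i) d) (dotc (w j t) (x i))
        <= dotc (dw j t) d].

(** All margins y f are unchanged by the double flip, hence so are the slopes. Results on neurons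
    with positive output weight and on the class +1 thereby transfer to the other sign. *)
Lemma relu_flow_opp (R : realType) n D h (x : 'I_n -> 'cV[R]_D) (y : 'I_n -> R)
    (lk : loss_kind) (Z : set R) (v dv : 'I_h -> R -> R) (w dw : 'I_h -> R -> 'cV[R]_D) :
  relu_flow x y lk Z v dv w dw ->
  relu_flow x (fun i => - y i) lk Z (fun j t => - v j t) (fun j t => - dv j t) w dw.
Proof.
have slopeE i t : - y i * \sum_j - v j t * relu (dotc (w j t) (x i)) =
    y i * \sum_j v j t * relu (dotc (w j t) (x i)).
  rewrite mulNr -mulrN -sumrN; congr (_ * _); apply: eq_bigr => j _.
  by rewrite mulNr opprK.
move=> [Z0 vd wd E1 E2]; split=> // [j|j t t0 Zt|j t d t0 Zt].
- exact: acdN.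
- rewrite E1// -sumrN; apply: eq_bigr => i _; by rewrite slopeE !mulNr.
- apply: le_trans (E2 j t d t0 Zt); apply: ler_sum => i _.
  by rewrite slopeE !mulNr mulrN !mulNr opprK.
Qed.

(** * From the Clarke inclusion to the motion of a single neuron *)

Section ClarkeFlow.
Variables (R : realType) (n D h : nat) (x : 'I_n -> 'cV[R]_D) (y : 'I_n -> R).
Variable lk : loss_kind.

Definition neuron_dir (j : 'I_h) (a : R) (d : 'cV[R]_D) : 'M[R]_(1 + D, h) :=
  \matrix_(r, c) if c == j then col_mx a%:M d r 0 else 0.

Lemma Vpart_neuron_dir j a d j' :
  Vpart (neuron_dir j a d) 0 j' = if j' == j then a else 0.
Proof. by rewrite 2!mxE col_mxEu mxE eqxx mulr1n. Qed.

Lemma Wpart_neuron_dir j a d j' :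
  col j' (Wpart (neuron_dir j a d)) = if j' == j then d else 0.
Proof.
apply/matrixP => k l; rewrite ord1 3!mxE col_mxEd.
by case: ifP => // _; rewrite mxE.
Qed.

Lemma frob_neuron_dir (A : 'M[R]_(1 + D, h)) j a d :
  frob_dot A (neuron_dir j a d) = Vpart A 0 j * a + dotc (col j (Wpart A)) d.
Proof.
rewrite /frob_dot; under eq_bigr => r _.
  rewrite (bigD1 j)//= big1 ?addr0; last by move=> c /negPf cj; rewrite mxE cj mulr0.
  rewrite mxE eqxx; over.
rewrite big_split_ord /= big_ord1 col_mxEu mxE eqxx mulr1n; congr (_ + _).
  by rewrite !mxE; congr (A _ _ * _); apply/val_inj.
by apply: eq_bigr => k _; rewrite col_mxEd !mxE.
Qed.

Lemma clarke_neuron (p xi : 'M[R]_(1 + D, h)) j a d :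
  clarke_subdiff (Loss lk x y) p xi ->
  Vpart xi 0 j * a + dotc (col j (Wpart xi)) d <=
  \sum_i (- (y i * loss_slope lk (y i * net p (x i))) * a *
            relu (dotc (col j (Wpart p)) (x i))
    - act_low (y i * loss_slope lk (y i * net p (x i)) * Vpart p 0 j * dotc (x i) d)
              (dotc (col j (Wpart p)) (x i))).
Proof.
move=> pxi; rewrite -frob_neuron_dir.
have al0 z : act_low (0 : R) z = 0 by rewrite /act_low minxx; case: ifP => // _; case: ifP.
have := clarke_subdiff_near pxi (@loss_quotient_le _ _ _ _ x y lk p (neuron_dir j a d)).
move=> /le_trans; apply; apply: ler_sum => i _.
rewrite (bigD1 j)//= big1 ?addr0; last first.
  move=> j' /negPf jj'; rewrite Vpart_neuron_dir Wpart_neuron_dir jj'.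
  by rewrite dotc0l !mulr0 mul0r oppr0 al0 subr0.
rewrite Vpart_neuron_dir Wpart_neuron_dir eqxx (dotcC d).
by rewrite !mulNr opprK.
Qed.

Lemma gradient_flow_relu_flow (th : R -> 'M[R]_(1 + D, h)) :
  gradient_flow (Loss lk x y) th -> exists Z dv dw,
  relu_flow x y lk Z (fun j t => Vpart (th t) 0 j) dv (fun j t => col j (Wpart (th t))) dw.
Proof.
move=> [thac Z0].
set Z := (X in negligible _ X) in Z0.
have Zg t : 0 <= t -> ~ Z t -> exists g : 'M[R]_(1 + D, h),
    (forall i j, derivable (fun s => th s i j) t 1 /\ 'D_1 (fun s => th s i j) t = g i j) /\
    clarke_subdiff (Loss lk x y) (th t) (- g).
  by move=> t0 nZ; apply: contrapT => H; apply: nZ; split.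
pose dth t := \matrix_(i, j) 'D_1 (fun s => th s i j) t.
have thd i j : acd Z (fun t => th t i j) (fun t => dth t i j).
  split=> [T T0|t t0 Zt]; first exact: thac.
  have [g [gd _]] := Zg t t0 Zt; rewrite mxE; apply: derivableP.
  by have [] := gd i j.
have dthP t : 0 <= t -> ~ Z t -> clarke_subdiff (Loss lk x y) (th t) (- dth t).
  move=> t0 Zt; have [g [gd]] := Zg t t0 Zt; congr (clarke_subdiff _ _ (- _)).
  by apply/matrixP => i j; rewrite mxE; have [_ ->] := gd i j.
exists Z, (fun j t => Vpart (dth t) 0 j), (fun j t => col j (Wpart (dth t))).
have VN (A : 'M[R]_(1 + D, h)) j : Vpart (- A) 0 j = - Vpart A 0 j by rewrite !mxE.
have WN (A : 'M[R]_(1 + D, h)) j : col j (Wpart (- A)) = - col j (Wpart A).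
  by apply/matrixP => k l; rewrite !mxE.
split=> //.
- move=> j; apply: acd_ext (thd (lshift D 0) j) _ _ => [t|t _ _]; by rewrite !mxE.
- move=> j k; apply: acd_ext (thd (rshift 1 k) j) _ _ => [t|t _ _]; by rewrite !mxE.
- move=> j t t0 Zt.
  have cl a := clarke_neuron j a 0 (dthP t t0 Zt).
  have al0 z : act_low (0 : R) z = 0 by rewrite /act_low minxx; case: ifP => // _; case: ifP.
  (* The loss is differentiable in the output weight, so the bounds for a = 1 and a = -1 are
     opposite and give an equality. *)
  have := cl 1; have := cl (-1).
  under eq_bigr do rewrite dotc0r mulr0 al0 subr0.
  under [in X in _ -> X]eq_bigr do rewrite dotc0r mulr0 al0 subr0.
  rewrite dotc0r addr0 VN => h1 h2.
  apply/eqP; rewrite eq_le; apply/andP; split.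
    move: h1; under eq_bigr do rewrite mulrN1 opprK.
    by rewrite mulrN1 opprK.
  move: h2; under eq_bigr do rewrite mulr1 mulNr.
  by rewrite mulr1 sumrN addr0 lerN2.
- move=> j t d t0 Zt; have := clarke_neuron j 0 d (dthP t t0 Zt).
  under eq_bigr do rewrite mulr0 mul0r sub0r.
  by rewrite mulr0 add0r WN dotcNl sumrN lerN2.
Qed.

End ClarkeFlow.

(** * Monotonicity of the activations *)

Lemma act_low_ge0 (R : realType) (k z : R) : 0 <= k -> 0 <= act_low k z.
Proof.
by move=> k0; rewrite /act_low; case: ifP => // _; case: ifP => // _; rewrite le_min k0 lexx.
Qed.

Lemma act_low_relu (R : realType) (c z : R) : act_low (c * z) z = c * relu z.
Proof.
rewrite /act_low; case: ltgtP => [z0|z0|<-].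
- by rewrite relu_pos// ltW.
- by rewrite relu_neg ?mulr0 ?ltW.
- by rewrite relu_neg// mulr0 minxx.
Qed.

Lemma near_pinfty_ge (R : realType) (P : set R) :
  (\forall t \near +oo, P t) -> exists2 T, 0 <= T & forall t, T <= t -> P t.
Proof.
move=> [M [_ H]]; exists (Num.max 0 (M + 1)) => [|t]; first by rewrite le_max lexx.
rewrite ge_max => /andP[_ Mt]; apply: H; lra.
Qed.

Section Alignment.
Variables (R : realType) (n D h : nat) (x : 'I_n -> 'cV[R]_D) (y : 'I_n -> R) (lk : loss_kind).
Variables (Z : set R) (v dv : 'I_h -> R -> R) (w dw : 'I_h -> R -> 'cV[R]_D) (mu : R).
Hypothesis flow : relu_flow x y lk Z v dv w dw.
Hypothesis yP : forall i, y i = 1 \/ y i = -1.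
Hypothesis x0 : forall i, x i != 0.
Hypothesis mu0 : 0 < mu.
Hypothesis sep : forall i k, mu * enorm (x i) * enorm (x k) <= y i * y k * dotc (x i) (x k).
Hypothesis init : forall j, enorm (w j 0) = `|v j 0|.
Hypothesis vinit : forall j, v j 0 != 0.

Local Notation z i j t := (dotc (w j t) (x i)).
Local Notation slope i t := (loss_slope lk (y i * \sum_j v j t * relu (z i j t))).

(** Along [w j] itself the kink is harmless: by [act_low_relu] the bound is linear in its
    coefficient, so the tests with [w j] and its opposite give d<w, w>/2 = v dv. *)
Lemma neuron_balance j t : 0 <= t -> dotc (w j t) (w j t) = v j t ^+ 2.
Proof.
case: flow => Z0 vd wd E1 E2 t0.
have fd := acdB (acd_dotc (wd j) (wd j)) (acdM (vd j) (vd j)).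
have := acd_constant Z0 fd (lexx 0) t0.
rewrite -(sqr_enorm (w j 0)) init real_normK ?num_real// -expr2 subrr => H.
apply/eqP; rewrite -subr_eq0 expr2 H// => {H} s /andP[s0 st] Zs.
have e1 := E2 j s (w j s) s0 Zs; have e2 := E2 j s (- w j s) s0 Zs.
have al i : act_low (y i * slope i s * v j s * dotc (x i) (w j s)) (z i j s) =
    y i * slope i s * relu (z i j s) * v j s by rewrite (dotcC (x i)) act_low_relu; ring.
have al' i : act_low (y i * slope i s * v j s * dotc (x i) (- w j s)) (z i j s) =
    - (y i * slope i s * relu (z i j s) * v j s).
  by rewrite (dotcC (x i)) dotcNl mulrN -mulNr act_low_relu; ring.
rewrite (eq_bigr _ (fun i _ => al i)) -mulr_suml -E1// in e1.
rewrite (eq_bigr _ (fun i _ => al' i)) sumrN -mulr_suml -E1// dotcNr lerN2 in e2.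
have e : dotc (dw j s) (w j s) = dv j s * v j s by apply/eqP; rewrite eq_le e2 e1.
by rewrite (dotcC (w j s)) e; ring.
Qed.

Lemma neuron_norm j t : 0 <= t -> enorm (w j t) = `|v j t|.
Proof. by move=> t0; rewrite /enorm neuron_balance// sqrtr_sqr. Qed.

Lemma activation_le i j t : 0 <= t -> `|z i j t| <= `|v j t| * enorm (x i).
Proof. by move=> t0; rewrite -neuron_norm// dotc_norm_le. Qed.

Lemma slope_bounded T : 0 < T -> exists2 G, 0 <= G & forall i t, 0 <= t <= T -> slope i t <= G.
Proof.
case: flow => Z0 vd wd E1 E2 T0.
have vb : exists B, forall j t, 0 <= t <= T -> `|v j t| <= B.
  have H j : exists B, forall t, 0 <= t <= T -> `|v j t| <= B.
    by apply: abs_cont_bounded; [exact: ltW|case: (vd j) => + _; apply].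
  have [B HB] := choice H; exists (\sum_j `|B j|) => j t tT.
  apply: le_trans (HB j t tT) _; apply: le_trans (ler_norm _) _.
  by rewrite (bigD1 j)//= lerDl sumr_ge0.
have [B HB] := vb.
pose X i := enorm (x i); pose K := \sum_i \sum_(j < h) B * (B * X i).
have B0 (j : 'I_h) : 0 <= B by apply: (le_trans (normr_ge0 (v j 0))); apply: HB; rewrite lexx ltW.
have Bx i (j : 'I_h) : 0 <= B * (B * X i) by rewrite !mulr_ge0 ?(B0 j)// enorm_ge0.
exists (2 * expR K); first by rewrite mulr_ge0// expR_ge0.
move=> i t tT; apply: le_trans (loss_slope_le _ _) _.
rewrite ler_pM2l// ler_expR; apply: le_trans (ler_norm _) _; rewrite normrN normrM.
have -> : `|y i| = 1 by case: (yP i) => ->; rewrite ?normrN normr1.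
rewrite mul1r; apply: le_trans (ler_norm_sum _ _ _) _.
apply: (@le_trans _ _ (\sum_(j < h) B * (B * X i))); last first.
  rewrite /K (bigD1 i)//= lerDl; apply: sumr_ge0 => k _.
  by apply: sumr_ge0 => j _; exact: Bx.
apply: ler_sum => j _; rewrite normrM ler_pM ?HB//.
have t0 : 0 <= t by case/andP: tT.
have := activation_le i j t0; have := relu_lip (z i j t) 0.
rewrite [relu 0]relu_neg// !subr0 => h1 h2; apply: le_trans h1 (le_trans h2 _).
by rewrite ler_wpM2r ?enorm_ge0// HB.
Qed.

(** Gronwall's argument: by the balance, the speed of [v j] is at most K times its absolute value on
    a bounded time interval, so [v j t * v j t * expR (2 * K * t)] cannot decrease. *)
Lemma neuron_neq0 j t : 0 <= t -> v j t != 0.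
Proof.
move=> t0; case: flow => Z0 vd wd E1 E2.
have [->//|tn0] := eqVneq t 0.
have tp : 0 < t by rewrite lt_neqAle eq_sym tn0.
have [G G0 HG] := slope_bounded tp.
pose K := \sum_i G * enorm (x i).
have fd := acdM (acdM (vd j) (vd j)) (acd_expR (acdZ (2 * K) (acd_id Z))).
have := acd_nondecreasing Z0 fd (lexx 0) t0.
have E := expR_gt0 (2 * K * t); rewrite !mulr0 expR0 mulr1 => H.
have : 0 < v j t * v j t * expR (2 * K * t).
  apply: lt_le_trans (H _); first by rewrite mulr1 -expr2 exprn_even_gt0//= vinit.
  move=> {E H} s /andP[s0 st] Zs; have E := expR_gt0 (2 * K * s).
  have : `|dv j s| <= K * `|v j s|.
    rewrite E1// mulr_suml; apply: le_trans (ler_norm_sum _ _ _) _.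
    apply: ler_sum => i _; rewrite -mulrA normrM.
    have -> : `|y i| = 1 by case: (yP i) => ->; rewrite ?normrN normr1.
    rewrite mul1r normrM (gtr0_norm (loss_slope_gt0 _ _)) -[X in _ <= X]mulrA.
    rewrite ler_pM ?(ltW (loss_slope_gt0 _ _))//.
      by apply: HG; rewrite s0.
    have := activation_le i j s0; have := relu_lip (z i j s) 0.
    by rewrite [relu 0]relu_neg// !subr0 mulrC => h1 h2; apply: le_trans h1 h2.
  move=> dvK.
  have : `|dv j s * v j s| <= K * (v j s * v j s).
    by rewrite normrM -expr2 -(real_normK (num_real (v j s))) expr2 mulrA ler_wpM2r.
  rewrite ler_norml => /andP[h1 h2].
  rewrite (_ : _ + _ =
    expR (2 * K * s) * (2 * (dv j s * v j s + K * (v j s * v j s)))); last by ring.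
  by apply: mulr_ge0; [exact: ltW|lra].
by rewrite pmulr_lgt0// => h1; apply/eqP => v0; move: h1; rewrite v0 mul0r ltxx.
Qed.

Lemma neuron_pos j t : 0 < v j 0 -> 0 <= t -> 0 < v j t.
Proof.
case: flow => Z0 vd _ _ _ v0 t0; have [->//|tn0] := eqVneq t 0.
apply: (abs_cont_pos t0) v0.
  by case: (vd j) => + _; apply; rewrite lt_neqAle eq_sym tn0.
by move=> s /andP[s0 _]; exact: neuron_neq0.
Qed.

Section PositiveNeuron.
Variable j : 'I_h.
Hypothesis vj0 : 0 < v j 0.

Lemma activation_le_pos i t : 0 <= t -> z i j t <= v j t * enorm (x i).
Proof.
move=> t0; rewrite -(gtr0_norm (neuron_pos vj0 t0)).
exact: le_trans (ler_norm _) (activation_le _ _ t0).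
Qed.

(** In the direction y_k x_k separability gives every sample a nonnegative coefficient, so samples
    at a kink or inactive cannot lower the bound. For an active sample the balance trades
    [v j t * enorm (x i)] for the activation. *)
Lemma activation_drift k t : 0 <= t -> ~ Z t ->
  mu * enorm (x k) * \sum_i slope i t * relu (z i j t) <= y k * dotc (dw j t) (x k).
Proof.
case: flow => Z0 vd wd E1 E2 t0 Zt.
rewrite -dotcZr; apply: le_trans (E2 j t (y k *: x k) t0 Zt).
rewrite mulr_sumr; apply: ler_sum => i _.
have v0 := neuron_pos vj0 t0; have s0 := loss_slope_gt0 lk
  (y i * \sum_j v j t * relu (z i j t)).
have sv : 0 <= slope i t * v j t by rewrite mulr_ge0// ltW.
have E : slope i t * v j t * (mu * enorm (x i) * enorm (x k)) <=
   y i * slope i t * v j t * dotc (x i) (y k *: x k).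
  rewrite dotcZr (_ : y i * _ * _ * _ = slope i t * v j t * (y i * y k * dotc (x i) (x k))).
    by rewrite ler_wpM2l.
  by ring.
case: (ltP 0 (z i j t)) => z0; last first.
  rewrite relu_neg// !mulr0; apply: act_low_ge0; apply: le_trans E.
  by rewrite !mulr_ge0 ?enorm_ge0// ltW.
rewrite /act_low z0 (relu_pos (ltW z0)); apply: le_trans E.
rewrite (_ : _ * _ = slope i t * mu * enorm (x k) * z i j t); last by ring.
rewrite (_ : _ * (mu * _ * _) = slope i t * mu * enorm (x k) * (v j t * enorm (x i))).
  by rewrite ler_wpM2l ?activation_le_pos// !mulr_ge0 ?enorm_ge0// ltW.
by ring.
Qed.

Lemma activation_monotone k s t : 0 <= s -> s <= t -> y k * z k j s <= y k * z k j t.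
Proof.
case: flow => Z0 vd wd E1 E2 s0 st.
apply: (acd_nondecreasing Z0 (acdZ (y k) (acd_dotcl (x k) (wd j)))) => // r /andP[sr rt] Zr.
apply: le_trans (activation_drift k (le_trans s0 sr) Zr).
apply: mulr_ge0; first by rewrite mulr_ge0 ?enorm_ge0// ltW.
apply: sumr_ge0 => i _.
by rewrite mulr_ge0 ?relu_ge0// ltW// loss_slope_gt0.
Qed.

(* Both sides grow at rates comparable to [\sum_i slope i t * relu (z i j t)], so a neuron
   can only grow together with all of its activations. *)
Lemma neuron_growth_le k t : 0 <= t ->
  v j t - v j 0 <= (y k * z k j t - y k * z k j 0) / (mu * enorm (x k)).
Proof.
case: flow => Z0 vd wd E1 E2 t0.
have mx : 0 < mu * enorm (x k) by rewrite mulr_gt0// enorm_gt0.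
have fd := acdB (acdZ (y k) (acd_dotcl (x k) (wd j))) (acdZ (mu * enorm (x k)) (vd j)).
have := acd_nondecreasing Z0 fd (lexx 0) t0.
rewrite ler_pdivlMr// => H.
suff : y k * z k j 0 - mu * enorm (x k) * v j 0 <= y k * z k j t - mu * enorm (x k) * v j t.
  lra.
apply: H => s /andP[s0 st] Zs; rewrite subr_ge0.
apply: le_trans (activation_drift k s0 Zs); rewrite ler_pM2l// E1//.
apply: ler_sum => i _; rewrite ler_wpM2r ?relu_ge0//.
rewrite ler_piMl ?(ltW (loss_slope_gt0 _ _))//; case: (yP i) => ->; lra.
Qed.

Lemma neuron_dichotomy : (exists B, forall t, 0 <= t -> v j t <= B) \/
  (forall B, \forall t \near +oo, forall k, B <= y k * z k j t).
Proof.
have [vb|vub] := pselect (exists B, forall t, 0 <= t -> v j t <= B); [by left|right=> B].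
apply: filter_forall => k.
have mx : 0 < mu * enorm (x k) by rewrite mulr_gt0// enorm_gt0.
(* This is the level of [v j] at which [neuron_growth_le] forces the activation up to B;
   monotonicity keeps it there. *)
have [s [s0 vs]] : exists s, 0 <= s /\
    v j 0 + (B - y k * z k j 0) / (mu * enorm (x k)) < v j s.
  apply: contrapT => /forallNP H; apply: vub.
  exists (v j 0 + (B - y k * z k j 0) / (mu * enorm (x k))) => t t0.
  by rewrite leNgt; apply/negP => vt; apply: (H t).
exists s; split; first exact: num_real.
move=> t /ltW st; apply: le_trans (activation_monotone k s0 st).
have : (B - y k * z k j 0) / (mu * enorm (x k)) <
    (y k * z k j s - y k * z k j 0) / (mu * enorm (x k)).
  apply: lt_le_trans (neuron_growth_le k s0); lra.
rewrite ltr_pM2r ?invr_gt0//; lra.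
Qed.

End PositiveNeuron.
End Alignment.

(** * Escaping neurons and their share of the margins *)

Definition escaping (R : realType) n D (x : 'I_n -> 'cV[R]_D) (y : 'I_n -> R)
    (wj : R -> 'cV[R]_D) : Prop :=
  forall B, \forall t \near +oo, forall k, B <= y k * dotc (wj t) (x k).

Section Decomposition.
Variables (R : realType) (n D h : nat) (x : 'I_n -> 'cV[R]_D) (y : 'I_n -> R) (lk : loss_kind).
Variables (Z : set R) (v dv : 'I_h -> R -> R) (w dw : 'I_h -> R -> 'cV[R]_D) (mu : R).
Hypothesis flow : relu_flow x y lk Z v dv w dw.
Hypothesis yP : forall i, y i = 1 \/ y i = -1.
Hypothesis x0 : forall i, x i != 0.
Hypothesis mu0 : 0 < mu.
Hypothesis sep : forall i k, mu * enorm (x i) * enorm (x k) <= y i * y k * dotc (x i) (x k).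
Hypothesis init : forall j, enorm (w j 0) = `|v j 0|.
Hypothesis vinit : forall j, v j 0 != 0.

Local Notation z i j t := (dotc (w j t) (x i)).

Let yoP i : - y i = 1 \/ - y i = -1.
Proof. by case: (yP i) => ->; [right|left; rewrite opprK]. Qed.

Let sepo i k : mu * enorm (x i) * enorm (x k) <= - y i * - y k * dotc (x i) (x k).
Proof. by rewrite mulrNN. Qed.

Let inito j : enorm (w j 0) = `|- v j 0|.
Proof. by rewrite normrN. Qed.

Let vinito j : - v j 0 != 0.
Proof. by rewrite oppr_eq0. Qed.

Let flowo := relu_flow_opp flow.

Lemma neuron_neg j t : v j 0 < 0 -> 0 <= t -> v j t < 0.
Proof.
move=> v0 t0; rewrite -oppr_gt0.
by apply: (neuron_pos flowo yoP inito vinito) => //; rewrite oppr_gt0.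
Qed.

Definition active_neuron : pred 'I_h :=
  [pred j | (0 < v j 0) && `[< escaping x y (w j) >]].

Lemma active_pos j : j \in active_neuron -> 0 < v j 0.
Proof. by case/andP. Qed.

Lemma active_escaping j : j \in active_neuron -> escaping x y (w j).
Proof. by case/andP => _ /asboolP. Qed.

Lemma inactive_bounded j : 0 < v j 0 -> j \notin active_neuron ->
  exists B, forall t, 0 <= t -> v j t <= B.
Proof.
move=> v0; rewrite inE v0 /= => /asboolPn jA.
by have [] := neuron_dichotomy flow yP x0 mu0 sep init vinit v0.
Qed.

(** If all positive neurons stayed bounded, so would the margin of k0 from above, since negative
    neurons only lower it. Its slope would then stay above some c > 0 and the activation of j0 on k0
    would grow linearly, against the bound on [v j0]. *)
Lemma active_neuron_exists k0 j0 : y k0 = 1 -> 0 < v j0 0 -> 0 < z k0 j0 0 ->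
  exists j, j \in active_neuron.
Proof.
move=> yk0 v0 z0; apply: contrapT => /forallNP noA.
have vb j : exists M, forall t, 0 <= t -> v j t * relu (z k0 j t) <= M.
  have [vj0|vj0] := ltP 0 (v j 0).
    have [|B HB] := inactive_bounded vj0; first by apply/negP; exact: noA.
    exists (B * (B * enorm (x k0))) => t t0.
    have vt := neuron_pos flow yP init vinit vj0 t0; have vB := HB t t0.
    have := activation_le_pos flow yP init vinit vj0 k0 t0.
    case: (leP (z k0 j t) 0) => zt zle.
      rewrite relu_neg// mulr0 !mulr_ge0 ?enorm_ge0//; lra.
    rewrite relu_pos ?(ltW zt)//; apply: ler_pM; rewrite ?(ltW vt) ?(ltW zt)//.
    by apply: le_trans zle _; rewrite ler_wpM2r ?enorm_ge0.
  have vj0' : v j 0 < 0 by rewrite lt_neqAle vinit.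
  by exists 0 => t t0; rewrite mulr_le0_ge0 ?relu_ge0// ltW// neuron_neg.
have [M HM] := choice vb.
pose c := loss_slope lk (\sum_j M j); have c0 : 0 < c by exact: loss_slope_gt0.
have [|B HB] := inactive_bounded v0; first by apply/negP; exact: noA.
have X0 : 0 < enorm (x k0) by rewrite enorm_gt0.
pose K := mu * enorm (x k0) * (c * z k0 j0 0).
have K0 : 0 < K by rewrite !mulr_gt0.
have zt t : 0 <= t -> z k0 j0 0 <= z k0 j0 t.
  move=> t0; have := activation_monotone flow yP mu0 sep init vinit v0 k0 (lexx 0) t0.
  by rewrite yk0 !mul1r.
have grow t : 0 <= t -> z k0 j0 0 + K * t <= z k0 j0 t.
  case: (flow) => Z0 vd wd E1 E2 t0.
  have := acd_nondecreasing Z0 (acdB (acd_dotcl (x k0) (wd j0)) (acdZ K (acd_id Z)))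
    (lexx 0) t0.
  rewrite !mulr0 mulr1 subr0 => H; suff : z k0 j0 0 <= z k0 j0 t - K * t by lra.
  apply: H => s /andP[s0 st] Zs; rewrite subr_ge0.
  have dr := activation_drift flow yP mu0 sep init vinit v0 k0 s0 Zs.
  rewrite yk0 mul1r in dr; apply: le_trans dr.
  rewrite ?mulr1 /K ler_pM2l ?mulr_gt0//.
  rewrite (bigD1 k0)//=; apply: ler_wpDr.
    by apply: sumr_ge0 => i _; rewrite mulr_ge0 ?relu_ge0// ltW// loss_slope_gt0.
  have zs := zt s s0.
  rewrite relu_pos; last exact: le_trans (ltW z0) zs.
  apply: ler_pM; rewrite ?(ltW c0) ?(ltW z0)//.
  apply: loss_slope_nonincreasing; rewrite yk0 mul1r; apply: ler_sum => j _.
  exact: HM.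
(* By this time linear growth alone exhausts the bound B * |x_k0| on the activation, and its initial
   value is positive. *)
pose t := (B * enorm (x k0)) / K.
have B0 : 0 < B by apply: lt_le_trans (HB 0 (lexx _)).
have t0 : 0 <= t by rewrite divr_ge0 ?mulr_ge0 ?ltW.
have := grow t t0; rewrite /t mulrC divfK ?gt_eqF// -/t => h1.
have := activation_le_pos flow yP init vinit v0 k0 t0.
have : v j0 t * enorm (x k0) <= B * enorm (x k0) by rewrite ler_pM2r// HB.
lra.
Qed.

(** On the class +1 an active neuron eventually has [relu z = z], a bounded neuron of either sign
    contributes a bounded amount, and an escaping negative neuron eventually contributes nothing. *)
Lemma margin_decomposition : exists P, \forall t \near +oo, forall i, y i = 1 ->
  `|y i * (\sum_j v j t * relu (z i j t)) - \sum_(j in active_neuron) v j t * z i j t| <= P.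
Proof.
have near0 : \forall t \near (+oo : set_system R), 0 <= t.
  by exists 0; split=> // t /ltW.
pose X := \sum_i enorm (x i).
have xX i : enorm (x i) <= X.
  by rewrite /X (bigD1 i)//= lerDl sumr_ge0// => k _; exact: enorm_ge0.
have bdd j B : (forall t, 0 <= t -> `|v j t| <= B) -> forall t, 0 <= t ->
    forall i, `|v j t * relu (z i j t)| <= B * (B * X).
  move=> HB t t0 i; rewrite normrM; apply: ler_pM; rewrite ?HB//.
  have := relu_lip (z i j t) 0; rewrite [relu 0]relu_neg// !subr0 => /le_trans; apply.
  apply: le_trans (activation_le flow init i j t0) _.
  by apply: ler_pM; rewrite ?enorm_ge0// HB.
have H j : exists b, \forall t \near +oo, forall i, y i = 1 ->
    `|v j t * relu (z i j t) - (if j \in active_neuron then v j t * z i j t else 0)| <= b.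
  case: (boolP (j \in active_neuron)) => jA.
    exists 0; apply: filterS (active_escaping jA 0) => t zt i yi.
    by have := zt i; rewrite yi mul1r => z0; rewrite relu_pos// subrr normr0.
  have [vj0|vj0] := ltP 0 (v j 0).
    have [B HB] := inactive_bounded vj0 jA; exists (B * (B * X)).
    apply: filterS near0 => t t0 i _; rewrite subr0; apply: bdd => // s s0.
    by rewrite gtr0_norm ?HB// (neuron_pos flow yP init vinit vj0).
  have vj0' : v j 0 < 0 by rewrite lt_neqAle vinit.
  have [|[B HB]|esc] := neuron_dichotomy flowo yoP x0 mu0 sepo inito vinito (j := j).
  - by rewrite oppr_gt0.
  - exists (B * (B * X)).
    apply: filterS near0 => t t0 i _; rewrite subr0; apply: bdd => // s s0.
    by rewrite ltr0_norm ?HB// neuron_neg.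
  - exists 0; apply: filterS (esc 0) => t zt i yi.
    have := zt i; rewrite yi mulN1r oppr_ge0 => z0.
    by rewrite relu_neg// mulr0 subr0 normr0.
have [b Hb] := choice H; exists (\sum_j b j).
have : \forall t \near +oo, forall j i, y i = 1 ->
    `|v j t * relu (z i j t) - (if j \in active_neuron then v j t * z i j t else 0)| <= b j.
  exact: filter_forall.
apply: filterS => t Ht i yi; rewrite yi mul1r [X in _ - X]big_mkcond -sumrB.
by apply: le_trans (ler_norm_sum _ _ _) _; apply: ler_sum => j _; exact: Ht.
Qed.

End Decomposition.

(** * Max-margin alignment of the escaping neurons *)

Lemma norm_le_of_sqr (R : realType) (a b : R) : 0 <= b -> a ^+ 2 <= b ^+ 2 -> `|a| <= b.
Proof.
by move=> b0; rewrite -(real_normK (num_real a)) ler_pXn2r// nnegrE.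
Qed.

(* [x * exp (-x) <= 1] makes the average of [q] for the weights [g] exceed its minimum by at
   most a constant. *)
Lemma softmin_le (R : realType) n (P : pred 'I_n) (g q : 'I_n -> R) (c0 c1 : R) (i1 : 'I_n) :
  0 < c0 -> P i1 ->
  (forall i, P i -> c0 * expR (- q i) <= g i <= c1 * expR (- q i)) ->
  \sum_(i | P i) g i * q i <= (q i1 + n%:R * (c1 / c0)) * \sum_(i | P i) g i.
Proof.
move=> c00 Pi1 gP.
have g0 i : P i -> 0 < g i.
  by move=> /gP /andP[+ _]; apply: lt_le_trans; rewrite mulr_gt0// expR_gt0.
have c10 : 0 < c1.
  have /andP[h1 h2] := gP _ Pi1; have := lt_le_trans (g0 _ Pi1) h2.
  by rewrite pmulr_lgt0// expR_gt0.
have K0 : 0 <= c1 / c0 by rewrite divr_ge0// ltW.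
have gi1 : g i1 <= \sum_(i | P i) g i.
  by rewrite (bigD1 i1)//= lerDl sumr_ge0// => i /andP[/g0/ltW].
rewrite mulrDl -lerBlDl [X in _ - X]mulr_sumr -sumrB.
apply: (@le_trans _ _ (\sum_(i | P i) c1 / c0 * g i1)); last first.
  apply: (@le_trans _ _ (n%:R * (c1 / c0 * g i1))).
    rewrite sumr_const -[X in X <= _]mulr_natl ler_wpM2r//.
      by rewrite mulr_ge0// ltW// g0.
    by rewrite ler_nat (leq_trans (max_card _))// card_ord.
  by rewrite [X in X <= _]mulrA; apply: ler_wpM2l => //; rewrite mulr_ge0.
apply: ler_sum => i Pi; rewrite -[X in _ - X]mulrC -mulrBr.
have [qi|qi] := leP (q i) (q i1).
  rewrite (@le_trans _ _ 0)//; first by rewrite mulr_ge0_le0// ?(ltW (g0 _ Pi))// subr_le0.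
  by rewrite mulr_ge0// ltW// g0.
have /andP[_ gi] := gP i Pi; have /andP[gi1' _] := gP i1 Pi1.
have d0 : 0 < q i - q i1 by rewrite subr_gt0.
apply: (@le_trans _ _ (c1 * expR (- q i1))); last first.
  rewrite mulrAC ler_pdivlMr// -mulrA ler_pM2l//.
  by rewrite mulrC.
apply: (@le_trans _ _ (c1 * expR (- q i) * (q i - q i1))); first by rewrite ler_wpM2r// ltW.
rewrite -mulrA ler_pM2l//.
have -> : - q i1 = - q i + (q i - q i1) by ring.
rewrite expRD ler_pM2l ?expR_gt0//.
have := expR_ge1Dx (q i - q i1); lra.
Qed.

Lemma near_pinfty_all (R : realType) (T : R) : \forall t \near +oo, T <= t.
Proof. by exists T; split; [exact: num_real|move=> t /ltW]. Qed.

Lemma nonincreasing_cvg_pinfty (R : realType) (f : R -> R) (T : R) :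
  (forall s t, T <= s -> s <= t -> f t <= f s) -> (forall t, T <= t -> 0 <= f t) ->
  exists l : R, f t @[t --> +oo] --> l.
Proof.
move=> fni f0; pose E := [set f t | t in [set t | T <= t]].
have infE : has_inf E.
  by split; [exists (f T); exists T => /=|exists 0 => _ [t Tt <-]; exact: f0].
exists (inf E); apply/cvgrPdist_lt => e e0.
have [_ [s /= Ts <-] fs] := inf_adherent e0 infE.
apply: filterS (near_pinfty_all s) => t st.
have : inf E <= f t by apply: ge_inf; [case: infE|exists t => //=; exact: le_trans st].
have := fni s t Ts st; rewrite ltr_norml; lra.
Qed.

Lemma cvg_inv_pinfty (R : realType) (f : R -> R) :
  (forall B, \forall t \near +oo, B <= f t) -> (f t)^-1 @[t --> +oo] --> 0.
Proof.
move=> fB; apply/cvgrPdist_lt => e e0; apply: filterS (fB (e^-1 + 1)) => t ft.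
have ei : 0 < e^-1 by rewrite invr_gt0.
have f0 : 0 < f t by lra.
rewrite sub0r normrN gtr0_norm ?invr_gt0// -[X in _ < X]invrK ltf_pV2 ?posrE//; lra.
Qed.

Lemma near_ln_ge (R : realType) (B : R) : \forall t \near +oo, 0 < t /\ B <= ln t.
Proof.
apply: filterS (near_pinfty_all (expR B)) => t Bt.
have t0 : 0 < t by apply: lt_le_trans Bt; exact: expR_gt0.
by split=> //; rewrite -[X in X <= _]expRK ler_ln ?posrE// expR_gt0.
Qed.

Lemma dotc_delta (R : realType) m (a : 'cV[R]_m) k : dotc a (delta_mx k 0) = a k 0.
Proof.
rewrite /dotc (bigD1 k)//= big1 ?addr0 ?mxE ?eqxx ?mulr1// => i /negPf ik.
by rewrite mxE ik mulr0.
Qed.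

(** * Joint dynamics of the escaping neurons of one class, with abstract sample weights *)

Section Direction.
Variables (R : realType) (n D h : nat) (x : 'I_n -> 'cV[R]_D).
Variables (P : pred 'I_n) (A : pred 'I_h) (Z : set R).
Variables (v dv : 'I_h -> R -> R) (w dw : 'I_h -> R -> 'cV[R]_D) (g : 'I_n -> R -> R).
Variables (T0 c0 c1 gam : R) (u : 'cV[R]_D) (i0 : 'I_n).

Local Notation z i j t := (dotc (w j t) (x i)).
Local Notation q i t := (\sum_(j | A j) v j t * z i j t).
Local Notation S t := (\sum_(j | A j) v j t ^+ 2).
Local Notation Gam t := (\sum_(i | P i) g i t).

Hypothesis Z0 : (@lebesgue_measure R).-negligible Z.
Hypothesis vd : forall j, acd Z (v j) (dv j).
Hypothesis wd : forall j k, acd Z (fun t => w j t k 0) (fun t => dw j t k 0).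
Hypothesis T00 : 0 <= T0.
Hypothesis dvE : forall j t, A j -> T0 <= t -> ~ Z t ->
  dv j t = \sum_(i | P i) g i t * z i j t.
Hypothesis dwE : forall j t d, A j -> T0 <= t -> ~ Z t ->
  dotc (dw j t) d = v j t * \sum_(i | P i) g i t * dotc (x i) d.
Hypothesis c00 : 0 < c0.
Hypothesis gP : forall i t, P i -> T0 <= t ->
  c0 * expR (- q i t) <= g i t <= c1 * expR (- q i t).
Hypothesis bal : forall j t, A j -> T0 <= t -> dotc (w j t) (w j t) = v j t ^+ 2.
Hypothesis vpos0 : forall j t, A j -> 0 <= t -> 0 < v j t.
Hypothesis vinf : forall B, \forall t \near +oo, forall j, A j -> B <= v j t.
Hypothesis gam0 : 0 < gam.
Hypothesis u1 : enorm u = 1.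
Hypothesis ug : forall i, P i -> gam <= dotc (x i) u.
Hypothesis Pi0 : P i0.
Hypothesis umax : forall u', enorm u' = 1 -> exists2 i, P i & dotc (x i) u' <= gam.
Variable a0 : 'I_h.
Hypothesis Aa0 : A a0.

Let vpos j t : A j -> T0 <= t -> 0 < v j t.
Proof. by move=> Aj /(le_trans T00); exact: vpos0. Qed.

Lemma weight_gt0 i t : P i -> T0 <= t -> 0 < g i t.
Proof.
move=> Pi tT; have /andP[+ _] := gP Pi tT; apply: lt_le_trans.
by rewrite mulr_gt0// expR_gt0.
Qed.

Lemma total_weight_gt0 t : T0 <= t -> 0 < Gam t.
Proof.
move=> tT; rewrite (bigD1 i0)//=; apply: ltr_pwDl; first exact: weight_gt0.
by apply: sumr_ge0 => i /andP[Pi _]; exact/ltW/weight_gt0.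
Qed.

Let Xm := \sum_i enorm (x i) + 1.

Let Xm0 : 0 < Xm.
Proof. by apply: ltr_wpDl => //; apply: sumr_ge0 => i _; exact: enorm_ge0. Qed.

Let le_Xm i : enorm (x i) <= Xm.
Proof.
rewrite /Xm (bigD1 i)//= -addrA lerDl addr_ge0//.
by apply: sumr_ge0 => k _; exact: enorm_ge0.
Qed.

Lemma gram_constant j k t : A j -> A k -> T0 <= t ->
  v j t * v k t - dotc (w j t) (w k t) = v j T0 * v k T0 - dotc (w j T0) (w k T0).
Proof.
move=> Aj Ak tT.
apply: (acd_constant Z0 (acdB (acdM (vd j) (vd k)) (acd_dotc (wd j) (wd k)))) => //.
move=> s /andP[Ts _] Zs; rewrite (dotcC (w j s)) !dwE// !dvE//.
under [X in _ - (v j s * X + _)]eq_bigr do rewrite (dotcC (x _)).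
under [X in _ - (_ + v k s * X)]eq_bigr do rewrite (dotcC (x _)).
ring.
Qed.

Lemma gram_bounded : exists2 M, 0 < M & forall j k t, A j -> A k -> T0 <= t ->
  2 * (v j t * v k t - dotc (w j t) (w k t)) <= M.
Proof.
pose m j k := 2 * (v j T0 * v k T0 - dotc (w j T0) (w k T0)).
exists (\sum_j \sum_k `|m j k| + 1).
  by apply: ltr_wpDl => //; apply: sumr_ge0 => j _; exact: sumr_ge0.
move=> j k t Aj Ak tT; rewrite gram_constant// -/(m j k).
apply: le_trans (ler_norm _) _.
rewrite (bigD1 j)//= (bigD1 k)//= -!addrA lerDl !addr_ge0//.
  exact: sumr_ge0.
by apply: sumr_ge0 => l _; exact: sumr_ge0.
Qed.

(** By the balance, the squared norm of v_k w_j - v_j w_k equals 2 v_j v_k (v_j v_k - <w_j, w_k>),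
    whose last factor is conserved; hence the factor 2 in [gram_bounded]. *)
Lemma direction_gap : exists2 M, 0 < M & forall j k t d, A j -> A k -> T0 <= t ->
  (v k t * dotc (w j t) d - v j t * dotc (w k t) d) ^+ 2
    <= enorm d ^+ 2 * (M * (v j t * v k t)).
Proof.
have [M M0 HM] := gram_bounded; exists M => // j k t d Aj Ak tT.
rewrite -!dotcZl -dotcBl -(real_normK (num_real (dotc _ _))) mulrC.
set e := (_ - _).
have : enorm e ^+ 2 <= M * (v j t * v k t).
  rewrite sqr_enorm /e dotcBl !dotcBr !dotcZl !dotcZr !bal// (dotcC (w k t)).
  rewrite (_ : _ - _ = 2 * (v j t * v k t - dotc (w j t) (w k t)) * (v j t * v k t)).
    by rewrite ler_wpM2r ?HM// mulr_ge0// ltW// vpos.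
  ring.
move=> eM; apply: (@le_trans _ _ (enorm e ^+ 2 * enorm d ^+ 2)).
  rewrite -exprMn ler_pXn2r ?nnegrE ?mulr_ge0 ?enorm_ge0//; exact: dotc_norm_le.
by rewrite ler_wpM2r// sqr_ge0.
Qed.

Lemma direction_gap_near delta : 0 < delta -> \forall t \near +oo, forall j k d, A j -> A k ->
  `|v k t * dotc (w j t) d - v j t * dotc (w k t) d| <= delta * enorm d * (v j t * v k t).
Proof.
move=> d0; have [M M0 HM] := direction_gap.
(* The threshold makes each weight at least 1 and one of them at least M / delta^2, so that their
   product dominates M / delta^2. *)
apply: filterS2 (near_pinfty_all T0) (vinf (1 + M / delta ^+ 2)) => t tT vB j k d Aj Ak.
have v0 l : A l -> 0 <= v l t by move=> Al; exact/ltW/vpos.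
have vj := vB _ Aj; have vk := vB _ Ak.
apply: norm_le_of_sqr; first by rewrite !mulr_ge0 ?enorm_ge0// ?v0// ltW.
apply: le_trans (HM _ _ _ _ Aj Ak tT) _.
rewrite [X in _ <= X](_ : _ = enorm d ^+ 2 *
  (delta ^+ 2 * (v j t * v k t) * (v j t * v k t))); last by ring.
rewrite ler_wpM2l ?sqr_ge0// ler_wpM2r ?mulr_ge0 ?v0//.
have B1 : 0 <= M / delta ^+ 2 by rewrite divr_ge0 ?ltW// exprn_gt0.
rewrite mulrC -ler_pdivrMr ?exprn_gt0//.
apply: (@le_trans _ _ ((1 + M / delta ^+ 2) * 1)); first lra.
by apply: ler_pM => //; lra.
Qed.

(** All q_i are inner products of x_i with one vector b = sum_j v_j w_j of norm at most S.
    Maximality of [gam] applied to b / |b| yields a sample with q_i <= gam S, and exponential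
    weights bring the mean within a constant of it. *)
Lemma mean_margin_le : exists2 K, 0 <= K & forall t, T0 <= t ->
  \sum_(i | P i) g i t * q i t <= (gam * S t + K) * Gam t.
Proof.
have c10 : 0 <= c1.
  have /andP[_ h2] := gP Pi0 (lexx T0); have := lt_le_trans (weight_gt0 Pi0 (lexx T0)) h2.
  by rewrite pmulr_lgt0 ?expR_gt0// => /ltW.
exists (n%:R * (c1 / c0)); first by rewrite mulr_ge0// divr_ge0// ltW.
move=> t tT; pose b := \sum_(j | A j) v j t *: w j t.
have qE i : q i t = dotc (x i) b.
  by rewrite dotc_sumr; apply: eq_bigr => j _; rewrite dotcZr dotcC.
have S0 : 0 <= S t by apply: sumr_ge0 => j _; exact: sqr_ge0.
have bS : enorm b <= S t.
  rewrite -(ler_pXn2r (n := 2)) ?nnegrE ?enorm_ge0// sqr_enorm dotc_suml expr2 mulr_suml.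
  apply: ler_sum => j Aj; rewrite dotc_sumr mulr_sumr; apply: ler_sum => k Ak.
  rewrite dotcZl dotcZr.
  have -> : v j t ^+ 2 * v k t ^+ 2 = v j t * (v k t * (v j t * v k t)) by ring.
  rewrite !ler_wpM2l ?(ltW (vpos _ _))//.
  by apply: le_trans (dotc_le _ _) _; rewrite /enorm !bal// !sqrtr_sqr !gtr0_norm ?vpos.
have [i1 Pi1 qi1] : exists2 i, P i & q i t <= gam * S t.
  have [b0|b0] := eqVneq b 0.
    by exists i0 => //; rewrite qE b0 dotc0r mulr_ge0// ltW.
  have nb : 0 < enorm b by rewrite enorm_gt0.
  have [|i Pi ig] := umax (u' := (enorm b)^-1 *: b).
    by rewrite enormZ gtr0_norm ?invr_gt0// mulVf// gt_eqF.
  exists i => //; rewrite qE; rewrite dotcZr ler_pdivrMl// in ig.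
  by apply: le_trans ig _; rewrite mulrC ler_wpM2l// ltW.
apply: le_trans (softmin_le c00 Pi1 (fun i Pi => gP Pi tT)) _.
by rewrite ler_wpM2r ?(ltW (total_weight_gt0 _))// lerD2r.
Qed.

(** As directions merge, z_i of neuron a is v_a q_i / S up to a small multiple of v_a. The
    derivative of v_a is thus governed by the weighted mean of the q_i. *)
Lemma norm_growth_le delta : 0 < delta -> \forall t \near +oo, forall a, A a -> ~ Z t ->
  dv a t <= (gam + delta) * (Gam t * v a t).
Proof.
move=> d0; have [K K0 HK] := mean_margin_le.
have d1 : 0 < delta / (2 * Xm) by rewrite divr_gt0// mulr_gt0.
(* Chosen so that S >= B gives K <= delta / 2 * S; B >= 1 lets v >= B imply v^2 >= B. *)
pose B := 1 + 2 * K / delta.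
have B1 : 1 <= B by rewrite lerDl divr_ge0 ?mulr_ge0// ltW.
apply: filterS3 (near_pinfty_all T0) (direction_gap_near d1) (vinf B).
move=> t tT gap vB a Aa Zt; have va := vpos Aa tT.
have St : B <= S t.
  rewrite (bigD1 a)//=; apply: ler_wpDr; first by apply: sumr_ge0 => *; exact: sqr_ge0.
  have vaB := vB a Aa; apply: le_trans vaB _; rewrite expr2 -[X in X <= _]mulr1.
  by rewrite ler_wpM2l ?(ltW va)// (le_trans B1 (vB a Aa)).
have S0 : 0 < S t by apply: lt_le_trans St; apply: lt_le_trans B1.
have G0 := total_weight_gt0 tT.
have key i : P i -> S t * z i a t <= v a t * q i t + delta / 2 * S t * v a t.
  move=> Pi; rewrite mulr_suml [X in _ <= X + _]mulr_sumr.
  rewrite (_ : delta / 2 * S t * v a t = \sum_(j | A j) delta / 2 * v a t * v j t ^+ 2).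
    rewrite -big_split /=; apply: ler_sum => j Aj.
    have vj := vpos Aj tT; have := gap a j (x i) Aa Aj.
    move=> /(le_trans (ler_norm _)).
    have : delta / (2 * Xm) * enorm (x i) <= delta / 2.
      have -> : delta / (2 * Xm) * enorm (x i) = delta / 2 * (enorm (x i) / Xm).
        by field; rewrite gt_eqF.
      by rewrite ler_piMr ?divr_ge0 ?(ltW d0)// ler_pdivrMr// mul1r.
    move=> /(ler_wpM2r (mulr_ge0 (ltW va) (ltW vj))) h1 h2.
    have := ler_wpM2l (ltW vj) (le_trans h2 h1); lra.
  by rewrite -mulr_sumr; ring.
have : S t * dv a t <= v a t * ((gam * S t + K) * Gam t) + delta / 2 * S t * v a t * Gam t.
  rewrite dvE// mulr_sumr.
  apply: (@le_trans _ _ (\sum_(i | P i) g i t * (v a t * q i t + delta / 2 * S t * v a t))).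
    apply: ler_sum => i Pi; rewrite mulrCA ler_wpM2l ?key//; exact/ltW/weight_gt0.
  under eq_bigr do rewrite mulrDr.
  rewrite big_split /= -mulr_suml (mulrC (Gam t)) lerD2r.
  under eq_bigr do rewrite mulrCA.
  by rewrite -mulr_sumr ler_wpM2l ?HK// ltW.
move=> h1; rewrite -(ler_pM2l S0); apply: le_trans h1 _.
have -> : S t * ((gam + delta) * (Gam t * v a t)) =
  v a t * ((gam * S t + delta / 2 * S t) * Gam t) + delta / 2 * S t * v a t * Gam t by field.
rewrite lerD2r ler_pM2l// ler_pM2r// lerD2l.
have : K * 2 / delta <= S t by move: St; rewrite /B; lra.
by rewrite ler_pdivrMr//; lra.
Qed.

(* [dv a <= (gam + delta) Gam (v a)] and [d<w a, u> >= gam Gam (v a)], so <w a, u> grows at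
   least [gam / (gam + delta)] times as fast as the norm of w a. *)
Lemma alignment_near eta : 0 < eta -> \forall t \near +oo, forall a, A a ->
  (1 - eta) * v a t <= dotc (w a t) u.
Proof.
move=> e0; have d0 : 0 < gam * (eta / 2) by rewrite mulr_gt0// divr_gt0.
have [T1 T10 H1] : exists2 T1, 0 <= T1 & forall t, T1 <= t -> T0 <= t /\
    forall a, A a -> ~ Z t -> dv a t <= (gam + gam * (eta / 2)) * (Gam t * v a t).
  apply: near_pinfty_ge; apply: filterI (near_pinfty_all T0) (norm_growth_le d0).
have TT : T0 <= T1 by case: (H1 T1 (lexx _)).
pose k := (1 + eta / 2)^-1.
have k0 : 0 < k by rewrite invr_gt0; lra.
have grow a t : A a -> T1 <= t ->
    dotc (w a T1) u - k * v a T1 <= dotc (w a t) u - k * v a t.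
  move=> Aa tT.
  apply: (acd_nondecreasing Z0 (acdB (acd_dotcl u (wd a)) (acdZ k (vd a)))) => //.
  move=> s /andP[Ts _] Zs; have [T0s /(_ a Aa Zs) hd] := H1 s Ts; rewrite subr_ge0.
  have -> : dotc (dw a s) u = v a s * \sum_(i | P i) g i s * dotc (x i) u by exact: dwE.
  have G0 := total_weight_gt0 T0s; have v0 := vpos Aa T0s.
  apply: (@le_trans _ _ (gam * (Gam s * v a s))).
    rewrite /k ler_pdivrMl; last lra.
    by rewrite (_ : _ * (gam * _) = (gam + gam * (eta / 2)) * (Gam s * v a s)); last by ring.
  rewrite mulrA mulrC ler_wpM2l ?(ltW v0)// mulr_sumr; apply: ler_sum => i Pi.
  by rewrite mulrC ler_wpM2l ?ug// ltW// weight_gt0.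
(* One half of [eta] is lost through k >= 1 - eta / 2; the other half absorbs the constant C once
   [v a] is large. *)
pose C := \sum_a `|dotc (w a T1) u - k * v a T1|.
apply: filterS2 (near_pinfty_all T1) (vinf (C / (eta / 2))) => t tT vB a Aa.
have := grow a t Aa tT; have v0 : 0 < v a t by apply: vpos => //; lra.
have : - C <= dotc (w a T1) u - k * v a T1.
  rewrite lerNl; apply: le_trans (ler_norm _) _; rewrite normrN /C (bigD1 a)//= lerDl.
  exact: sumr_ge0.
have := vB a Aa; rewrite ler_pdivrMr ?divr_gt0// => h1 h2 h3.
have : (1 - eta / 2) * v a t <= k * v a t.
  rewrite ler_wpM2r ?(ltW v0)// /k -[X in _ <= X]mul1r ler_pdivlMr; last lra.
  have := sqr_ge0 (eta / 2); lra.
lra.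
Qed.

Lemma direction_near delta : 0 < delta -> \forall t \near +oo, forall a d, A a ->
  `|dotc (w a t) d - v a t * dotc u d| <= delta * enorm d * v a t.
Proof.
(* By the balance |w - v u|^2 = 2 v (v - <w, u>), so alignment up to delta^2 / 2 puts w within delta
   v of v u. *)
move=> d0; have e0 : 0 < delta ^+ 2 / 2 by rewrite divr_gt0// exprn_gt0.
apply: filterS2 (near_pinfty_all T0) (alignment_near e0) => t tT al a d Aa.
have v0 := vpos Aa tT.
rewrite -dotcZl -dotcBl; apply: le_trans (dotc_norm_le _ _) _.
rewrite mulrAC ler_wpM2r ?enorm_ge0// -[enorm _]ger0_norm ?enorm_ge0//.
apply: norm_le_of_sqr; first by rewrite mulr_ge0// ltW.
rewrite sqr_enorm dotcBl !dotcBr !dotcZl !dotcZr bal// (dotcC u (w a t)).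
rewrite -(sqr_enorm u) u1 expr1n.
have := ler_wpM2l (ltW v0) (al a Aa); rewrite exprMn.
lra.
Qed.

Lemma activation_near delta : 0 < delta -> \forall t \near +oo, forall i a, P i -> A a ->
  `|z i a t - v a t * dotc (x i) u| <= delta * v a t.
Proof.
move=> d0; have d1 : 0 < delta / Xm by rewrite divr_gt0.
apply: filterS2 (near_pinfty_all T0) (direction_near d1) => t tT dir i a Pi Aa.
rewrite (dotcC (x i)); apply: le_trans (dir a (x i) Aa) _.
rewrite ler_wpM2r ?(ltW (vpos _ _))//.
by rewrite -mulrA ler_piMr ?(ltW d0)// ler_pdivrMl// mulr1.
Qed.

(* The distance of two directions is of order [(v j * v a)^-1/2], and [Gam <= C * dv a / v a],
   so the logarithmic derivative of [1 + v j / v a] is at most [C * dv a / v a ^+ 2], the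
   derivative of [- C / v a]. *)
Lemma ratio_cvg j a : A j -> A a -> exists r : R, v j t / v a t @[t --> +oo] --> r.
Proof.
move=> Aj Aa; have [M M0 HM] := direction_gap.
(* [C1] avoids square roots: M <= (M + 1)^2 and v_j v_a <= (v_j + v_a)^2. The factor 2 / gam comes
   from dv_a >= (gam / 2) Gam v_a. *)
pose C1 := (M + 1) * Xm; pose C := C1 * 2 / gam.
have C10 : 0 < C1 by rewrite mulr_gt0//; lra.
have g2 : 0 < gam / 2 by rewrite divr_gt0.
have [T1 T10 H1] : exists2 T1, 0 <= T1 & forall t, T1 <= t -> T0 <= t /\
    forall i a, P i -> A a -> `|z i a t - v a t * dotc (x i) u| <= gam / 2 * v a t.
  by apply: near_pinfty_ge; apply: filterI (near_pinfty_all T0) (activation_near g2).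
pose F t := (1 + v j t * (v a t)^-1) * expR (C * (v a t)^-1).
have va0 t : 0 <= t -> 0 < v a t by exact: vpos0.
have Vd := acdV va0 (vd a).
have Fd := acdM (acdD (acd_cst Z 1) (acdM (vd j) Vd)) (acd_expR (acdZ C Vd)).
have [l Fl] : exists l : R, F t @[t --> +oo] --> l.
  apply: (@nonincreasing_cvg_pinfty _ _ T1); last first.
    move=> t /(le_trans T10) t0; apply: mulr_ge0; last exact: expR_ge0.
    by rewrite addr_ge0// mulr_ge0 ?invr_ge0// ltW// vpos0.
  move=> s t Ts st; apply: (acd_nonincreasing Z0 Fd) => //; first exact: le_trans Ts.
  move=> r /andP[sr rt] Zr; have Tr := le_trans Ts sr; have [T0r act] := H1 r Tr.
  have vj := vpos Aj T0r; have va := vpos Aa T0r.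
  set e := expR _; rewrite [X in X <= _](_ : _ = e * (v a r ^+ 2)^-1 *
    (dv j r * v a r - v j r * dv a r - (v a r + v j r) * (C * (dv a r / v a r)))); last first.
    by field; rewrite gt_eqF.
  rewrite mulr_ge0_le0//.
    by rewrite mulr_ge0 ?expR_ge0// invr_ge0 sqr_ge0.
  have G0 := total_weight_gt0 T0r.
  have dva : gam / 2 * (Gam r * v a r) <= dv a r.
    rewrite dvE// mulrCA mulr_suml; apply: ler_sum => i Pi.
    rewrite ler_wpM2l ?(ltW (weight_gt0 _ _))//.
    have := act i a Pi Aa; rewrite ler_norml => /andP[+ _].
    have := ler_wpM2l (ltW va) (ug Pi); lra.
  have dvb : C1 * Gam r <= C * (dv a r / v a r).
    have -> : C * (dv a r / v a r) = C1 * ((dv a r / v a r) / (gam / 2)).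
      by rewrite /C; field; rewrite !gt_eqF.
    by rewrite ler_pM2l// ler_pdivlMr// ler_pdivlMr//; lra.
  have gap : dv j r * v a r - v j r * dv a r <= Gam r * (C1 * (v j r + v a r)).
    rewrite !dvE// mulr_suml mulr_sumr -sumrB mulr_suml; apply: ler_sum => i Pi.
    rewrite (_ : _ - _ = g i r * (v a r * z i j r - v j r * z i a r)); last by ring.
    rewrite ler_wpM2l ?(ltW (weight_gt0 _ _))//; apply: le_trans (ler_norm _) _.
    apply: norm_le_of_sqr; first by rewrite mulr_ge0 ?(ltW C10)// addr_ge0 ?ltW.
    apply: le_trans (HM _ _ _ _ Aj Aa T0r) _.
    have vv0 : 0 <= v j r * v a r by rewrite mulr_ge0 ?ltW.
    have e1 : enorm (x i) ^+ 2 <= Xm ^+ 2.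
      by rewrite ler_pXn2r ?nnegrE ?enorm_ge0 ?(ltW Xm0).
    have e2 : M <= (M + 1) ^+ 2 by have := sqr_ge0 M; lra.
    have e3 : v j r * v a r <= (v j r + v a r) ^+ 2.
      by have := sqr_ge0 (v j r); have := sqr_ge0 (v a r); lra.
    have e4 := ler_pM (ltW M0) vv0 e2 e3.
    have e5 := ler_pM (sqr_ge0 _) (mulr_ge0 (ltW M0) vv0) e1 e4.
    by apply: le_trans e5 _; rewrite /C1 !exprMn mulrA (mulrC (Xm ^+ 2)).
  have : (v a r + v j r) * (C1 * Gam r) <= (v a r + v j r) * (C * (dv a r / v a r)).
    by rewrite ler_wpM2l// addr_ge0 ?ltW.
  lra.
exists (l * (expR (C * 0))^-1 - 1).
have inv0 : (v a t)^-1 @[t --> +oo] --> 0.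
  by apply: cvg_inv_pinfty => B; apply: filterS (vinf B) => t; exact.
have ec : expR (C * (v a t)^-1) @[t --> +oo] --> expR (C * 0).
  apply: (@continuous_cvg _ _ _ _ _ (fun t => C * (v a t)^-1) (@expR R)); first exact: continuous_expR.
  by apply: cvgM => //; exact: cvg_cst.
have Fc : F t * (expR (C * (v a t)^-1))^-1 - 1 @[t --> +oo] --> l * (expR (C * 0))^-1 - 1.
  apply: cvgB; last exact: cvg_cst.
  by apply: cvgM => //; exact: (cvgV (lt0r_neq0 (expR_gt0 _)) ec).
apply: cvg_trans Fc; apply: near_eq_cvg; near=> t.
by rewrite /F mulfK ?gt_eqF ?expR_gt0// addrAC subrr add0r.
Unshelve. all: by end_near. Qed.

(** * Logarithmic growth of the squared output weights *)

Lemma sqnorm_derivE t : T0 <= t -> ~ Z t ->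
  \sum_(j | A j) (dv j t * v j t + v j t * dv j t) = 2 * \sum_(i | P i) g i t * q i t.
Proof.
move=> tT Zt; under [in RHS]eq_bigr do rewrite mulr_sumr.
rewrite exchange_big mulr_sumr; apply: eq_bigr => j Aj.
rewrite dvE// mulr_suml mulr_sumr -big_split mulr_sumr /=.
by apply: eq_bigr => i _; ring.
Qed.

Lemma sqnorm_acd : acd Z (fun t => S t)
  (fun t => \sum_(j | A j) (dv j t * v j t + v j t * dv j t)).
Proof. by apply: acd_sum => j _; apply: acd_ext (acdM (vd j) (vd j)) _ _. Qed.

Lemma sqnorm_large B : \forall t \near +oo, B <= S t.
Proof.
apply: filterS2 (near_pinfty_all T0) (vinf (1 + `|B|)) => t tT vB.
have va := vB _ Aa0; rewrite (bigD1 a0)//=; apply: ler_wpDr.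
  by apply: sumr_ge0 => *; exact: sqr_ge0.
apply: le_trans (ler_norm B) _; apply: (@le_trans _ _ (v a0 t * 1)); first lra.
have B0 := normr_ge0 B; rewrite expr2 ler_wpM2l; lra.
Qed.

Lemma margin_near delta : 0 < delta -> \forall t \near +oo,
  (forall i, P i -> (gam - delta) * S t <= q i t /\ q i t <= Xm * S t) /\
  q i0 t <= (dotc (x i0) u + delta) * S t.
Proof.
move=> d0; apply: filterS2 (near_pinfty_all T0) (activation_near d0) => t tT act.
split=> [i Pi|]; first split.
- rewrite mulr_sumr; apply: ler_sum => j Aj; have vj := vpos Aj tT.
  have := act i j Pi Aj; rewrite ler_norml => /andP[+ _].
  have := ler_wpM2l (ltW vj) (ug Pi) => h1 h2.
  have h3 : (gam - delta) * v j t <= z i j t by lra.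
  have := ler_wpM2l (ltW vj) h3; lra.
- rewrite mulr_sumr; apply: ler_sum => j Aj; have vj := vpos Aj tT.
  rewrite expr2 mulrCA ler_wpM2l ?(ltW vj)//; apply: le_trans (dotc_le _ _) _.
  by rewrite /enorm bal// sqrtr_sqr gtr0_norm// mulrC ler_wpM2r ?(ltW vj)// le_Xm.
- rewrite mulr_sumr; apply: ler_sum => j Aj; have vj := vpos Aj tT.
  have := act i0 j Pi0 Aj; rewrite ler_norml => /andP[_ h2].
  have h3 : z i0 j t <= (dotc (x i0) u + delta) * v j t by lra.
  have := ler_wpM2l (ltW vj) h3; lra.
Qed.

(** The derivative 2 sum_i g_i q_i is at most K exp (- (gam - 2 delta) S): one delta comes from q_i
    >= (gam - delta) S, the other absorbs the factor q_i <= Xm S. Hence exp ((gam - 2 delta) S)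
    grows at most linearly. *)
Lemma sqnorm_upper delta : 0 < delta -> 2 * delta < gam -> \forall t \near +oo,
  (gam - 2 * delta) * S t <= (1 + delta) * ln t.
Proof.
move=> d0 dg; pose la := gam - 2 * delta; have la0 : 0 < la by rewrite subr_gt0.
have c10 : 0 < c1.
  have /andP[_ h2] := gP Pi0 (lexx T0); have := lt_le_trans (weight_gt0 Pi0 (lexx T0)) h2.
  by rewrite pmulr_lgt0 ?expR_gt0.
pose K := 2 * (n%:R * (c1 * (Xm / delta))).
have K0 : 0 <= K by rewrite !mulr_ge0 ?ler0n ?invr_ge0 ?ltW.
have [T1 T10 H1] : exists2 T1, 0 <= T1 & forall t, T1 <= t -> T0 <= t /\ (0 <= S t /\
   ((forall i, P i -> (gam - delta) * S t <= q i t /\ q i t <= Xm * S t) /\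
    q i0 t <= (dotc (x i0) u + delta) * S t)).
  apply: near_pinfty_ge; apply: filterI (near_pinfty_all T0) _.
  exact: filterI (sqnorm_large 0) (margin_near d0).
have dS t : T1 <= t -> ~ Z t -> \sum_(j | A j) (dv j t * v j t + v j t * dv j t)
    <= K * expR (- (la * S t)).
  move=> Tt Zt; have [T0t [S0 [qS _]]] := H1 t Tt; rewrite sqnorm_derivE// -mulrA ler_pM2l//.
  apply: (@le_trans _ _ (\sum_(i < n) c1 * (Xm / delta) * expR (- (la * S t)))).
    rewrite big_mkcond; apply: ler_sum => i _; case: ifPn => Pi; last first.
      by rewrite !mulr_ge0 ?invr_ge0 ?expR_ge0 ?ltW.
    have [q1 q2] := qS i Pi; have /andP[_ g2] := gP Pi T0t.
    have q0 : 0 <= q i t by apply: le_trans q1; rewrite mulr_ge0//; lra.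
    apply: (@le_trans _ _ (c1 * expR (- ((gam - delta) * S t)) * (Xm * S t))).
      apply: ler_pM => //; first by rewrite ltW// weight_gt0.
      by apply: le_trans g2 _; rewrite ler_wpM2l ?(ltW c10)// ler_expR lerN2.
    have -> : - (la * S t) = - ((gam - delta) * S t) + delta * S t by rewrite /la; ring.
    rewrite expRD; set e := expR (- _); have e0 : 0 <= e by exact: expR_ge0.
    have h1 : S t <= expR (delta * S t) / delta.
      by rewrite ler_pdivlMr// mulrC; have := expR_ge1Dx (delta * S t); lra.
    have h2 : 0 <= c1 * Xm * e by rewrite !mulr_ge0// ltW.
    by have := ler_wpM2l h2 h1; lra.
  by rewrite sumr_const card_ord -[X in X <= _]mulr_natl !mulrA.
pose E := expR (la * S T1).
have up t : T1 <= t -> expR (la * S t) - la * K * t <= E - la * K * T1.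
  move=> Tt; apply: (acd_nonincreasing Z0
    (acdB (acd_expR (acdZ la sqnorm_acd)) (acdZ (la * K) (acd_id Z)))) => //.
  move=> s /andP[Ts _] Zs; rewrite mulr1 subr_le0 mulrCA ler_pM2l//.
  apply: le_trans (ler_wpM2l (expR_ge0 _) (dS s Ts Zs)) _.
  by rewrite mulrCA -expRD subrr expR0 mulr1.
pose C := la * K + E; have E0 : 0 < E by exact: expR_gt0.
have C0 : 0 < C by rewrite ltr_wpDl// mulr_ge0// ltW.
apply: filterS3 (near_pinfty_all T1) (near_pinfty_all 1) (near_ln_ge (ln C / delta)).
move=> t Tt t1 [t0 lnt]; have upt := up t Tt.
have lK : 0 <= la * K by rewrite mulr_ge0// ltW.
have : expR (la * S t) <= C * t.
  have h1 : 0 <= la * K * T1 by rewrite mulr_ge0.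
  have : E * 1 <= E * t by rewrite ler_pM2l.
  rewrite /C; lra.
rewrite -ler_ln ?posrE ?expR_gt0 ?mulr_gt0// expRK lnM ?posrE// => h1.
move: lnt; rewrite ler_pdivrMr// -/la; lra.
Qed.

Hypothesis ui0 : dotc (x i0) u = gam.

Lemma sqnorm_lower delta : 0 < delta -> 2 * delta < gam -> \forall t \near +oo,
  (1 - delta) * ln t <= (gam + delta) * S t.
Proof.
move=> d0 dg; pose la := gam + delta; have la0 : 0 < la by rewrite addr_gt0.
pose K := 2 * c0; have K0 : 0 < K by rewrite mulr_gt0.
have [T1 T10 H1] : exists2 T1, 0 <= T1 & forall t, T1 <= t -> T0 <= t /\
   ((gam - delta)^-1 <= S t /\
   ((forall i, P i -> (gam - delta) * S t <= q i t /\ q i t <= Xm * S t) /\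
    q i0 t <= (dotc (x i0) u + delta) * S t)).
  apply: near_pinfty_ge; apply: filterI (near_pinfty_all T0) _.
  exact: filterI (sqnorm_large _) (margin_near d0).
have gd : 0 < gam - delta by lra.
have dS t : T1 <= t -> ~ Z t -> K * expR (- (la * S t)) <=
    \sum_(j | A j) (dv j t * v j t + v j t * dv j t).
  move=> Tt Zt; have [T0t [S1 [qS qi0]]] := H1 t Tt; rewrite sqnorm_derivE// -mulrA ler_pM2l//.
  have q1 i : P i -> 1 <= q i t.
    move=> Pi; have [h1 _] := qS i Pi; apply: le_trans h1.
    by rewrite -ler_pdivrMl// mulr1.
  rewrite (bigD1 i0)//=; apply: ler_wpDr.
    apply: sumr_ge0 => i /andP[Pi _]; rewrite mulr_ge0//; first exact/ltW/weight_gt0.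
    by have := q1 i Pi; lra.
  have /andP[g1 _] := gP Pi0 T0t.
  apply: (@le_trans _ _ (g i0 t * 1)); last first.
    by rewrite ler_wpM2l ?q1// ltW// weight_gt0.
  rewrite mulr1; apply: le_trans g1; rewrite ler_pM2l// ler_expR lerN2.
  by rewrite /la -ui0.
have lo t : T1 <= t -> expR (la * S T1) - la * K * T1 <= expR (la * S t) - la * K * t.
  move=> Tt; apply: (acd_nondecreasing Z0
    (acdB (acd_expR (acdZ la sqnorm_acd)) (acdZ (la * K) (acd_id Z)))) => //.
  move=> s /andP[Ts _] Zs; rewrite mulr1 subr_ge0 [X in _ <= X]mulrCA ler_pM2l//.
  apply: le_trans _ (ler_wpM2l (expR_ge0 _) (dS s Ts Zs)).
  by rewrite mulrCA -expRD subrr expR0 mulr1.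
(* Half of the slope remains after subtracting the value at T1, because t - T1 >= t / 2 when t >= 2
   T1. *)
pose C := la * K / 2; have C0 : 0 < C by rewrite divr_gt0// mulr_gt0.
apply: filterS3 (near_pinfty_all T1) (near_pinfty_all (2 * T1)) (near_ln_ge (- ln C / delta)).
move=> t Tt t1 [t0 lnt]; have lot := lo t Tt.
have lK : 0 <= la * K by rewrite mulr_ge0// ltW.
have : C * t <= expR (la * S t).
  have := expR_gt0 (la * S T1); have := ler_wpM2l lK t1; rewrite /C; lra.
rewrite -ler_ln ?posrE ?expR_gt0 ?mulr_gt0// expRK lnM ?posrE// => h1.
move: lnt; rewrite ler_pdivrMr// -/la; lra.
Qed.

Lemma sqnorm_cvg : S t / ln t @[t --> +oo] --> gam^-1.
Proof.
suff H : gam * (S t / ln t) @[t --> +oo] --> (1 : R).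
  have : gam^-1 * (gam * (S t / ln t)) @[t --> +oo] --> gam^-1 * 1.
    by apply: cvgM => //; exact: cvg_cst.
  by rewrite mulr1; under eq_fun do rewrite mulKf ?gt_eqF//.
apply/cvgrPdist_le => e e0.
have B0 : 0 < 1 + 8 / gam by rewrite addr_gt0// divr_gt0.
(* The first two bounds give s <= 4 / gam; the error of gam s is then at most delta + 2 delta s <=
   delta (1 + 8 / gam). *)
pose delta := Num.min (Num.min (gam / 4) (1 / 2)) (e / (1 + 8 / gam)).
have d0 : 0 < delta by rewrite !lt_min !divr_gt0.
have d1 : delta <= gam / 4 by rewrite !ge_min lexx.
have d2 : delta <= 1 / 2 by rewrite !ge_min lexx orbT.
have d3 : delta * (1 + 8 / gam) <= e by rewrite -ler_pdivlMr// ge_min lexx orbT.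
have dg : 2 * delta < gam by lra.
have ln1 := @near_ln_ge R 1.
apply: filterS3 (sqnorm_upper d0 dg) (sqnorm_lower d0 dg) ln1 => t up lo [t0 lnt].
have l0 : 0 < ln t by lra.
set s := S t / ln t.
have up' : (gam - 2 * delta) * s <= 1 + delta by rewrite /s mulrA ler_pdivrMr.
have lo' : 1 - delta <= (gam + delta) * s by rewrite /s mulrA ler_pdivlMr.
have s0 : 0 <= s by rewrite divr_ge0 ?(ltW l0)//; apply: sumr_ge0 => *; exact: sqr_ge0.
have s4 : s <= 4 / gam.
  rewrite ler_pdivlMr//; have h1 : (gam / 2) * s <= (gam - 2 * delta) * s.
    by rewrite ler_wpM2r//; lra.
  lra.
have ds : delta * s <= delta * (4 / gam) by rewrite ler_wpM2l ?(ltW d0).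
have dg0 : 0 <= delta / gam by rewrite divr_ge0// ltW.
rewrite ler_norml; lra.
Qed.

Lemma neuron_limits : exists rho : 'I_h -> R,
  [/\ forall j, 0 <= rho j,
    \sum_(j | A j) rho j ^+ 2 = gam^-1,
    forall j, A j -> v j t / Num.sqrt (ln t) @[t --> +oo] --> rho j &
    forall j k, A j -> w j t k 0 / Num.sqrt (ln t) @[t --> +oo] --> rho j * u k 0].
Proof.
have rex j : exists r : R, A j -> v j t / v a0 t @[t --> +oo] --> r.
  have [Aj|nAj] := pselect (A j); last by exists 0.
  by have [r rc] := ratio_cvg Aj Aa0; exists r.
have [r rc] := choice rex.
have v0 t : T0 <= t -> 0 < v a0 t by exact: vpos.
have r0 j : A j -> 0 <= r j.
  move=> Aj; apply: cvgr_to_ge (rc j Aj) _.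
  by apply: filterS (near_pinfty_all T0) => t tT; rewrite divr_ge0// ltW// vpos.
pose r2 := \sum_(j | A j) r j ^+ 2.
have Sr : S t / v a0 t ^+ 2 @[t --> +oo] --> r2.
  have : \sum_(j | A j) (v j t / v a0 t) ^+ 2 @[t --> +oo] --> r2.
    by apply: cvg_rsum => j Aj; rewrite expr2; apply: cvgM; exact: rc.
  apply: cvg_trans; apply: near_eq_cvg; near=> t.
  by rewrite mulr_suml; apply: eq_bigr => j _; rewrite exprMn exprVn.
have r21 : 1 <= r2.
  apply: cvgr_to_ge Sr _; apply: filterS (near_pinfty_all T0) => t tT.
  rewrite ler_pdivlMr ?exprn_gt0 ?v0// mul1r (bigD1 a0)//= lerDl.
  by apply: sumr_ge0 => *; exact: sqr_ge0.
have r20 : 0 < r2 by lra.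
(* S / ln t tends to 1 / gam and S / v_a0^2 to r2, so their quotient determines the growth of the
   reference neuron [a0], and the ratios that of the others. *)
pose kap := Num.sqrt (gam^-1 / r2).
have kap2 : kap ^+ 2 = gam^-1 / r2 by rewrite sqr_sqrtr// divr_ge0 ?invr_ge0 ?ltW.
have va : v a0 t / Num.sqrt (ln t) @[t --> +oo] --> kap.
  have h1 : Num.sqrt ((S t / ln t) / (S t / v a0 t ^+ 2)) @[t --> +oo] --> kap.
    apply: (@continuous_cvg _ _ _ _ _ (fun t => S t / ln t / (S t / v a0 t ^+ 2)) (@Num.sqrt R)); first exact: sqrt_continuous.
    by apply: cvgM; [exact: sqnorm_cvg|exact: (cvgV (lt0r_neq0 r20) Sr)].
  apply: cvg_trans h1; apply: near_eq_cvg.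
  apply: filterS3 (near_pinfty_all T0) (sqnorm_large 1) (@near_ln_ge R 1).
  move=> t tT S1 [t0 l1].
  have l0 : 0 < ln t by lra.
  have vt := v0 t tT; have S0 : S t != 0 by rewrite gt_eqF//; lra.
  have -> : (S t / ln t) / (S t / v a0 t ^+ 2) = v a0 t ^+ 2 * (ln t)^-1.
    by field; rewrite S0 !gt_eqF// ?exprn_gt0.
  by rewrite sqrtrM ?sqr_ge0// sqrtr_sqr gtr0_norm// sqrtrV// ltW.
pose rho j := if A j then r j * kap else 0.
have vr j : A j -> v j t / Num.sqrt (ln t) @[t --> +oo] --> rho j.
  move=> Aj; rewrite /rho Aj.
  apply: cvg_trans (cvgM (rc j Aj) va); apply: near_eq_cvg.
  apply: filterS (near_pinfty_all T0) => t tT.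
  by rewrite /= mulrA divfK// gt_eqF// v0.
exists rho; split=> //.
- by move=> j; rewrite /rho; case: ifPn => // Aj; rewrite mulr_ge0 ?r0 ?sqrtr_ge0.
- rewrite (eq_bigr (fun j => r j ^+ 2 * kap ^+ 2)); last first.
    by move=> j Aj; rewrite /rho Aj exprMn.
  by rewrite -mulr_suml kap2 mulrC divfK// gt_eqF.
- move=> j k Aj.
  have wu : w j t k 0 / v j t @[t --> +oo] --> u k 0.
    apply/cvgrPdist_le => e e0.
    have ed : 0 < e / (enorm (delta_mx k 0 : 'cV[R]_D) + 1).
      by rewrite divr_gt0// ltr_wpDl// enorm_ge0.
    apply: filterS2 (near_pinfty_all T0) (direction_near ed) => t tT dir.
    have := dir j (delta_mx k 0) Aj; rewrite !dotc_delta.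
    have vt := vpos Aj tT.
    rewrite (_ : w j t k 0 - _ = (w j t k 0 / v j t - u k 0) * v j t); last first.
      by field; rewrite gt_eqF.
    rewrite normrM (gtr0_norm vt) ler_pM2r// distrC => /le_trans; apply.
    rewrite mulrAC ler_pdivrMr; last by rewrite ltr_wpDl// enorm_ge0.
    by rewrite ler_wpM2l ?(ltW e0)// lerDl.
  rewrite mulrC; apply: cvg_trans (cvgM wu (vr j Aj)); apply: near_eq_cvg.
  apply: filterS (near_pinfty_all T0) => t tT.
  by rewrite /= mulrA divfK// gt_eqF// vpos.
Unshelve. all: by end_near. Qed.

End Direction.

(** * Limits of the normalised parameters *)

Lemma cvg_mx (R : realType) m n (T : Type) (F : set_system T) (FF : Filter F)
  (f : T -> 'M[R]_(m, n)) (l : 'M[R]_(m, n)) :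
  (forall i j, f t i j @[t --> F] --> l i j) -> f @ F --> l.
Proof.
move=> fl B [C lC CB].
suff : \forall t \near F, forall i j, C i j (f t i j) by apply: filterS => t; exact: CB.
by apply: filter_forall => i; apply: filter_forall => j; exact: fl (lC i j).
Qed.

Lemma cvg_inv_sqrt_ln (R : realType) :
  (Num.sqrt (ln t))^-1 @[t --> (+oo : set_system R)] --> (0 : R).
Proof.
apply: cvg_inv_pinfty => B; apply: filterS (near_ln_ge (B ^+ 2)) => t [_ Bt].
by apply: le_trans (ler_norm B) _; rewrite -sqrtr_sqr ler_wsqrtr.
Qed.

Lemma bounded_div_sqrt_ln (R : realType) (f : R -> R) (B : R) :
  (\forall t \near +oo, `|f t| <= B) -> f t / Num.sqrt (ln t) @[t --> +oo] --> (0 : R).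
Proof.
move=> fB; have BL : `|B| * (Num.sqrt (ln t))^-1 @[t --> +oo] --> (0 : R).
  by rewrite -[X in _ --> X](mulr0 `|B|); apply: cvgM; [exact: cvg_cst|exact: cvg_inv_sqrt_ln].
apply/cvgrPdist_lt => e e0.
have BL' : \forall t \near +oo, `|B| * (Num.sqrt (ln t))^-1 < e by exact: cvgr_lt BL _ e0.
apply: filterS2 fB BL' => t ft; apply: le_lt_trans.
rewrite sub0r normrN normrM [`|_^-1|]ger0_norm ?invr_ge0 ?sqrtr_ge0//.
by rewrite ler_wpM2r ?invr_ge0 ?sqrtr_ge0// (le_trans ft)// ler_norm.
Qed.

Lemma dotc_cvg (R : realType) m (f : R -> 'cV[R]_m) (l d : 'cV[R]_m) (s : R -> R) :
  (forall k, f t k 0 / s t @[t --> +oo] --> l k 0) ->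
  dotc (f t) d / s t @[t --> +oo] --> dotc l d.
Proof.
move=> fl; have : \sum_(k < m) (f t k 0 / s t) * d k 0 @[t --> +oo] --> dotc l d.
  by apply: cvg_rsum => k _; apply: cvgM => //; exact: cvg_cst.
apply: cvg_trans; apply: near_eq_cvg; apply: nearW => t.
by rewrite /dotc mulr_suml; apply: eq_bigr => k _; rewrite mulrAC.
Qed.

Section ClassLimits.
Variables (R : realType) (n D h : nat) (x : 'I_n -> 'cV[R]_D) (y : 'I_n -> R) (lk : loss_kind).
Variables (Z : set R) (v dv : 'I_h -> R -> R) (w dw : 'I_h -> R -> 'cV[R]_D) (mu : R).
Hypothesis flow : relu_flow x y lk Z v dv w dw.
Hypothesis yP : forall i, y i = 1 \/ y i = -1.
Hypothesis x0 : forall i, x i != 0.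
Hypothesis mu0 : 0 < mu.
Hypothesis sep : forall i k, mu * enorm (x i) * enorm (x k) <= y i * y k * dotc (x i) (x k).
Hypothesis init : forall j, enorm (w j 0) = `|v j 0|.
Hypothesis vinit : forall j, v j 0 != 0.
Variables (k0 : 'I_n) (j0 : 'I_h).
Hypothesis yk0 : y k0 = 1.
Hypothesis vj0 : 0 < v j0 0.
Hypothesis zj0 : 0 < dotc (w j0 0) (x k0).
Variables (gam : R) (u : 'cV[R]_D) (i0 : 'I_n).
Hypothesis gam0 : 0 < gam.
Hypothesis u1 : enorm u = 1.
Hypothesis ug : forall i, y i = 1 -> gam <= dotc (x i) u.
Hypothesis yi0 : y i0 = 1.
Hypothesis ui0 : dotc (x i0) u = gam.
Hypothesis umax : forall u', enorm u' = 1 -> exists2 i, y i = 1 & dotc (x i) u' <= gam.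

Local Notation z i j t := (dotc (w j t) (x i)).
Local Notation slope i t := (loss_slope lk (y i * \sum_j v j t * relu (z i j t))).
Local Notation A := (active_neuron x y v w).

(** Once the activations of an escaping neuron have strict signs, no kink remains: the lower bound
    is linear in the test direction, and d with -d turns it into an equality. *)
Lemma active_flow : exists T0, [/\ 0 <= T0,
    forall j t, A j -> T0 <= t -> ~ Z t ->
      dv j t = \sum_(i | y i == 1) slope i t * z i j t &
    forall j t d, A j -> T0 <= t -> ~ Z t ->
      dotc (dw j t) d = v j t * \sum_(i | y i == 1) slope i t * dotc (x i) d].
Proof.
have [T0 T00 H] : exists2 T0, 0 <= T0 & forall t, T0 <= t ->
    forall j, A j -> forall i, 1 <= y i * z i j t.
  apply: near_pinfty_ge; apply: filter_forall => j.
  have [Aj|nAj] := boolP (A j); last exact: nearW.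
  by apply: filterS (active_escaping Aj 1) => t zt _.
case: (flow) => Z0 vd wd E1 E2.
have pos j t i : A j -> T0 <= t -> y i == 1 -> 0 < z i j t.
  by move=> Aj tT /eqP yi; have := H t tT j Aj i; rewrite yi mul1r => /(lt_le_trans ltr01).
have neg j t i : A j -> T0 <= t -> y i != 1 -> z i j t < 0.
  move=> Aj tT yi; have := H t tT j Aj i; case: (yP i) yi => [->|->]; rewrite ?eqxx//; lra.
exists T0; split=> // [j t Aj tT Zt|j t d Aj tT Zt].
  rewrite E1 ?(le_trans T00)// [RHS]big_mkcond; apply: eq_bigr => i _; case: ifPn => yi.
    by rewrite {1}(eqP yi) mul1r (relu_pos (ltW (pos _ _ _ Aj tT yi))).
  by rewrite (relu_neg (ltW (neg _ _ _ Aj tT yi))) mulr0.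
have t0 : 0 <= t by exact: le_trans tT.
have low e : v j t * \sum_(i | y i == 1) slope i t * dotc (x i) e <= dotc (dw j t) e.
  apply: le_trans (E2 j t e t0 Zt); rewrite mulr_sumr big_mkcond; apply: ler_sum => i _.
  rewrite /act_low; case: ifPn => yi.
    by rewrite pos// [X in _ <= X * _ * _ * _](eqP yi) mul1r mulrA (mulrC (v j t)).
  by rewrite ltNge (ltW (neg _ _ _ Aj tT yi)) /= lt_eqF ?neg.
apply/eqP; rewrite eq_le low andbT -lerN2 -dotcNr -mulrN -sumrN.
by under eq_bigr do rewrite -mulrN -dotcNr; exact: low.
Qed.

Lemma active_weights : exists T0 c0 c1, [/\ 0 <= T0, 0 < c0 &
  forall i t, y i = 1 -> T0 <= t ->
    c0 * expR (- \sum_(j | A j) v j t * z i j t) <= slope i t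
      <= c1 * expR (- \sum_(j | A j) v j t * z i j t)].
Proof.
have [P HP] := margin_decomposition flow yP x0 mu0 sep init vinit.
have [c c0 Hc] := loss_slope_ge lk P.
have zA : \forall t \near +oo, forall j, A j -> forall i, 0 <= y i * z i j t.
  apply: filter_forall => j.
  have [Aj|nAj] := boolP (A j); last exact: nearW.
  by apply: filterS (active_escaping Aj 0) => t zt _.
have [T0 T00 H] := near_pinfty_ge (filterI zA HP).
exists T0, (c * expR (- P)), (2 * expR P); split=> // [|i t yi tT].
  by rewrite mulr_gt0// expR_gt0.
have [zpos /(_ i yi)] := H t tT; rewrite ler_norml => /andP[h1 h2].
set m := y i * _ in h1 h2 *; set q := \sum_(j | A j) _ in h1 h2 *.
have q0 : 0 <= q.
  apply: sumr_ge0 => j Aj; apply: mulr_ge0; last by have := zpos j Aj i; rewrite yi mul1r.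
  exact/ltW/(neuron_pos flow yP init vinit (active_pos Aj))/(le_trans T00).
apply/andP; split.
  apply: le_trans (Hc m _); last lra.
  by rewrite -mulrA -expRD ler_pM2l// ler_expR; lra.
by apply: le_trans (loss_slope_le _ _) _; rewrite -mulrA -expRD ler_pM2l// ler_expR; lra.
Qed.

Lemma class_limits : exists rho : 'I_h -> R,
  [/\ forall j, 0 <= rho j,
    \sum_j rho j ^+ 2 = gam^-1,
    forall j, v j 0 < 0 -> rho j = 0,
    forall i, y i = -1 -> dotc (x i) u <= 0 &
    forall j, 0 < v j 0 -> v j t / Num.sqrt (ln t) @[t --> +oo] --> rho j /\
      forall k, w j t k 0 / Num.sqrt (ln t) @[t --> +oo] --> rho j * u k 0].
Proof.
have [T1 [T10 dvE dwE]] := active_flow.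
have [T2 [c0 [c1 [T20 c00 HG]]]] := active_weights.
have [a0 Aa0] := active_neuron_exists flow yP x0 mu0 sep init vinit yk0 vj0 zj0.
pose T0 := Num.max T1 T2.
have T01 t : T0 <= t -> T1 <= t by rewrite ge_max => /andP[].
have T02 t : T0 <= t -> T2 <= t by rewrite ge_max => /andP[].
have T00 : 0 <= T0 by rewrite le_max T10.
case: (flow) => Z0 vd wd _ _.
have vinf B : \forall t \near +oo, forall j, A j -> B <= v j t.
  apply: filter_forall => j.
  have [Aj|nAj] := boolP (A j); last exact: nearW.
  apply: filterS2 (near_pinfty_all 0) (active_escaping Aj (B * enorm (x k0))) => t t0 zt _.
  have X0 : 0 < enorm (x k0) by rewrite enorm_gt0.
  rewrite -(ler_pM2r X0); have := zt k0; rewrite yk0 mul1r => /le_trans; apply.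
  exact: (activation_le_pos flow yP init vinit (active_pos Aj)).
have [||||||||rho [rho0 rho2 vlim wlim]] := @neuron_limits R n D h x
    [pred i | y i == 1] A Z v dv w dw (fun i t => slope i t) T0 c0 c1 gam u i0
    Z0 vd wd T00 _ _ c00 _ _ _ vinf gam0 u1 _ _ _ a0 Aa0 ui0.
- by move=> j t Aj /T01; exact: dvE.
- by move=> j t d Aj /T01; exact: dwE.
- by move=> i t /eqP yi /T02; exact: HG.
- by move=> j t Aj tT; exact: (neuron_balance flow init j (le_trans T00 tT)).
- by move=> j t Aj; exact: (neuron_pos flow yP init vinit (active_pos Aj)).
- by move=> i /eqP; exact: ug.
- by rewrite /= yi0.
- by move=> u' /umax[i yi ui]; exists i; rewrite //= yi.
exists (fun j => if A j then rho j else 0); split.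
- by move=> j; case: ifP.
- by rewrite -rho2 [RHS]big_mkcond; apply: eq_bigr => j _; case: ifP => // _; rewrite expr0n.
- by move=> j v0; case: ifPn => // Aj; have := active_pos Aj; rewrite ltNge ltW.
(* The sign of u on the other class is inherited in the limit from an escaping neuron, whose
   activations there are eventually nonpositive. *)
- move=> i yi.
  have [j Aj rj] : exists2 j, A j & 0 < rho j.
    apply: contrapT => H; have : \sum_(j | A j) rho j ^+ 2 = 0.
      apply: big1 => j Aj; apply/eqP; rewrite sqrf_eq0.
      have [//|rj] := eqVneq (rho j) 0; exfalso; apply: H.
      by exists j => //; rewrite lt_neqAle eq_sym rj rho0.
    by rewrite rho2 => /eqP; rewrite invr_eq0 gt_eqF.
  have := @dotc_cvg _ _ (w j) (rho j *: u) (x i) (fun t => Num.sqrt (ln t)).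
  rewrite dotcZl dotcC => H.
  have {}H : z i j t / Num.sqrt (ln t) @[t --> +oo] --> rho j * dotc (x i) u.
    by apply: H => k; rewrite mxE; exact: wlim.
  have : rho j * dotc (x i) u <= 0.
    apply: cvgr_to_le H _; apply: filterS (active_escaping Aj 0) => t /(_ i).
    by rewrite yi mulN1r oppr_ge0 => zt; rewrite mulr_le0_ge0// invr_ge0 sqrtr_ge0.
  by rewrite pmulr_rle0.
- move=> j vj; case: ifPn => Aj.
    by split; [exact: vlim|move=> k; exact: wlim].
  have [B HB] := inactive_bounded flow yP x0 mu0 sep init vinit vj Aj.
  have vB : \forall t \near +oo, `|v j t| <= B.
    apply: filterS (near_pinfty_all 0) => t t0.
    by rewrite gtr0_norm ?HB// (neuron_pos flow yP init vinit vj t0).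
  split=> [|k]; first exact: bounded_div_sqrt_ln vB.
  rewrite mul0r; apply: (@bounded_div_sqrt_ln _ _ B).
  apply: filterS2 (near_pinfty_all 0) vB => t t0; apply: le_trans.
  by rewrite -(neuron_norm flow init j t0) enorm_coord.
Qed.

End ClassLimits.

(** Finiteness of the class makes the minimum of any unit direction attained, so that maximality of
    u can be applied to it. Positivity of [gam] comes from the direction of a single sample of the
    class. *)
Lemma max_marginP (R : realType) n D (x : 'I_n -> 'cV[R]_D) (y : 'I_n -> R) (k gam : R)
  (u : 'cV[R]_D) (i1 : 'I_n) :
  y i1 = k -> (forall i j, y i = k -> y j = k -> 0 < dotc (x i) (x j)) ->
  is_max_margin x y k gam u ->
  [/\ 0 < gam, exists2 i, y i = k & dotc (x i) u = gam &
    forall u', enorm u' = 1 -> exists2 i, y i = k & dotc (x i) u' <= gam].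
Proof.
move=> yi1 pos [u1 [[ug [i0 [yi0 ui0]]] umax]].
have um u' : enorm u' = 1 -> exists2 i, y i = k & dotc (x i) u' <= gam.
  move=> u'1; have yk1 : y i1 == k by exact/eqP.
  case: (@Order.TotalTheory.arg_minP _ _ _ i1 (fun i => y i == k) (fun i => dotc (x i) u') yk1).
  move=> i /eqP yi imin; exists i => //; apply: (umax u') => //.
  by split; [move=> j /eqP; exact: imin|exists i].
split=> //; last by exists i0.
have x1 : 0 < enorm (x i1) by rewrite enorm_gt0 -dotc_eq0 gt_eqF// pos.
have [|i yi] := um ((enorm (x i1))^-1 *: x i1).
  by rewrite enormZ gtr0_norm ?invr_gt0// mulVf// gt_eqF.
by apply: lt_le_trans; rewrite dotcZr mulr_gt0 ?invr_gt0// pos.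
Qed.

Lemma is_max_margin_opp (R : realType) n D (x : 'I_n -> 'cV[R]_D) (y : 'I_n -> R)
  (gam : R) (u : 'cV[R]_D) :
  is_max_margin x y (-1) gam u -> is_max_margin x (fun i => - y i) 1 gam u.
Proof.
have E i : - y i = 1 -> y i = -1 by move=> <-; rewrite opprK.
have E' i : y i = -1 -> - y i = 1 by move=> ->; rewrite opprK.
move=> [u1 [[ug [i0 [yi0 ui0]]] umax]]; split=> //; split.
  by split=> [i /E|]; [exact: ug|exists i0; split=> //; exact: E'].
move=> u' g' u'1 [ug' [i [/E yi ui]]]; apply: (umax u') => //.
by split=> [j /E'|]; [exact: ug'|exists i].
Qed.

(** * Assembly of the two classes *)

Lemma frob_cvg (R : realType) m n (f : R -> 'M[R]_(m, n)) (s : R -> R) (l : 'M[R]_(m, n)) :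
  (\forall t \near +oo, 0 < s t) ->
  (forall i j, f t i j / s t @[t --> +oo] --> l i j) ->
  frob (f t) / s t @[t --> +oo] --> frob l.
Proof.
move=> s0 fl.
have h1 : Num.sqrt (\sum_i \sum_j (f t i j / s t) * (f t i j / s t)) @[t --> +oo] --> frob l.
  apply: (@continuous_cvg _ _ _ _ _
    (fun t => \sum_i \sum_j (f t i j / s t) * (f t i j / s t)) (@Num.sqrt R)).
    exact: sqrt_continuous.
  by apply: cvg_rsum => i _; apply: cvg_rsum => j _; apply: cvgM; exact: fl.
apply: cvg_trans h1; apply: near_eq_cvg; apply: filterS s0 => t st.
have -> : \sum_i \sum_j (f t i j / s t) * (f t i j / s t) = frob_dot (f t) (f t) * (s t)^-1 ^+ 2.
  rewrite mulr_suml; apply: eq_bigr => i _; rewrite mulr_suml; apply: eq_bigr => j _.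
  by rewrite expr2 mulrACA.
rewrite sqrtrM ?sqrtr_sqr ?ger0_norm ?invr_ge0 ?(ltW st)//.
by apply: sumr_ge0 => i _; apply: sumr_ge0 => j _; rewrite -expr2 sqr_ge0.
Qed.

Lemma normalized_cvg (R : realType) m n (f : R -> 'M[R]_(m, n)) (s : R -> R)
  (l : 'M[R]_(m, n)) :
  (\forall t \near +oo, 0 < s t) -> 0 < frob l ->
  (forall i j, f t i j / s t @[t --> +oo] --> l i j) ->
  (fun t => (frob (f t))^-1 *: f t) @ +oo --> (frob l)^-1 *: l.
Proof.
move=> s0 l0 fl; apply: cvg_mx => i j; rewrite mxE.
have fr := frob_cvg s0 fl.
have h1 : (frob (f t) / s t)^-1 * (f t i j / s t) @[t --> +oo] --> (frob l)^-1 * l i j.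
  by apply: cvgM; [exact: (cvgV (lt0r_neq0 l0) fr)|exact: fl].
apply: cvg_trans h1; apply: near_eq_cvg; apply: filterS s0 => t st.
by rewrite mxE invfM invrK mulrACA divff ?mulr1 ?gt_eqF.
Qed.

Theorem theorem1 (R : realType) (n D h : nat)
  (x : 'I_n -> 'cV[R]_D) (y : 'I_n -> R)
  (w0 : 'M[R]_(D, h)) (v0 : 'rV[R]_h)
  (gp gm : R) (up um : 'cV[R]_D) (lk : loss_kind) :
  (forall i, y i = 1 \/ y i = -1) ->
  (exists i, y i = 1) -> (exists i, y i = -1) ->
  (forall i, x i != 0) ->
  orth_separable x y ->
  (2 <= h)%N ->
  (forall j, col j w0 != 0) -> (forall j, v0 0 j != 0) ->
  (forall j, enorm (col j w0) = `|v0 0 j|) ->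
  nondegenerate_init x y w0 v0 ->
  is_max_margin x y 1 gp up -> is_max_margin x y (-1) gm um ->
  exists eps0 : R, 0 < eps0 /\
    forall (eps : R) (th : R -> 'M[R]_(1 + D, h)),
      0 < eps -> eps < eps0 ->
      th 0 = eps *: col_mx v0 w0 ->
      gradient_flow (Loss lk x y) th ->
      exists thb : 'M[R]_(1 + D, h),
        ((fun t => (frob (th t))^-1 *: th t) @ +oo --> thb) /\
        exists phip phim : 'cV[R]_h,
          enorm phip = 1 /\ enorm phim = 1 /\
          (forall i, y i = 1 ->
             feat thb (x i) = dotc (s_coef gp gp gm *: up) (x i) *: phip) /\
          (forall i, y i = -1 ->
             feat thb (x i) = dotc (s_coef gm gp gm *: um) (x i) *: phim) /\
          (forall j, 0 <= phip j 0) /\ (forall j, 0 <= phim j 0) /\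
          dotc phip phim = 0 /\
          Vpart thb = s_coef gp gp gm *: phip^T - s_coef gm gp gm *: phim^T.
Proof.
move=> yP _ _ x0 [mus [mud [mus0 [_ [mud0 [same diff]]]]]] _ w0n v0n bal.
move=> [_ [_ [[kp [jp [ykp [vjp zjp]]]] [[km [jm [ykm [vjm zjm]]]] _]]]] mmp mmm.
exists 1; split=> // eps th eps0 _ th0 /gradient_flow_relu_flow[Z [dv [dw flow]]].
pose mu := Num.min mus mud.
have mu0 : 0 < mu by rewrite lt_min mus0.
have sep i k : mu * enorm (x i) * enorm (x k) <= y i * y k * dotc (x i) (x k).
  have E a : mu <= a -> mu * enorm (x i) * enorm (x k) <= a * enorm (x i) * enorm (x k).
    by move=> ma; rewrite !ler_wpM2r ?enorm_ge0.
  have [yik|yik] := eqVneq (y i) (y k).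
    have -> : y i * y k = 1.
      by rewrite yik; case: (yP k) => ->; rewrite ?mulrNN mulr1.
    by rewrite mul1r; apply: le_trans (E mus _) (same i k yik); rewrite ge_min lexx.
  have -> : y i * y k = -1.
    by case: (yP i) yik => ->; case: (yP k) => ->; rewrite ?eqxx ?mulr1 ?mul1r.
  have ne : y i <> y k by apply/eqP.
  rewrite mulN1r lerNr; apply: le_trans (diff i k ne) _.
  by rewrite lerN2; apply: E; rewrite ge_min lexx orbT.
have V0 j : Vpart (th 0) 0 j = eps * v0 0 j by rewrite th0 2!mxE col_mxEu.
have W0 j : col j (Wpart (th 0)) = eps *: col j w0.
  by rewrite th0; apply/matrixP => k l; rewrite 3!mxE col_mxEd !mxE.
have init j : enorm (col j (Wpart (th 0))) = `|Vpart (th 0) 0 j|.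
  by rewrite W0 enormZ bal V0 normrM.
have vinit j : Vpart (th 0) 0 j != 0 by rewrite V0 mulf_neq0 ?v0n// gt_eqF.
have pos k i j : y i = k -> y j = k -> 0 < dotc (x i) (x j).
  move=> yi yj; apply: lt_le_trans (same i j _); last by rewrite yi yj.
  by rewrite !mulr_gt0 ?enorm_gt0.
have mmm' := is_max_margin_opp mmm.
have [gp0 [ip yip uip] upmax] := max_marginP ykp (pos 1) mmp.
have poso i j : - y i = 1 -> - y j = 1 -> 0 < dotc (x i) (x j).
  by move=> yi yj; apply: (pos (-1)); [rewrite -yi opprK|rewrite -yj opprK].
have ykmo : - y km = 1 by rewrite ykm opprK.
have [gm0 [im yim uim] ummax] := max_marginP ykmo poso mmm'.
have vjp0 : 0 < Vpart (th 0) 0 jp by rewrite V0 mulr_gt0.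
have zjp0 : 0 < dotc (col jp (Wpart (th 0))) (x kp).
  by rewrite W0 dotcZl dotcC mulr_gt0.
have vjm0 : 0 < - Vpart (th 0) 0 jm by rewrite V0 -mulrN mulr_gt0 ?oppr_gt0.
have zjm0 : 0 < dotc (col jm (Wpart (th 0))) (x km).
  by rewrite W0 dotcZl dotcC mulr_gt0.
have [up1 [[upg _] _]] := mmp; have [um1 [[umg _] _]] := mmm'.
have [rp [rp0 rp2 rpn upx plim]] := class_limits flow yP x0 mu0 sep init vinit ykp
  vjp0 zjp0 gp0 up1 upg yip uip upmax.
have yoP i : - y i = 1 \/ - y i = -1.
  by case: (yP i) => ->; [right|left; rewrite opprK].
have sepo i k : mu * enorm (x i) * enorm (x k) <= - y i * - y k * dotc (x i) (x k).
  by rewrite mulrNN.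
have inito j : enorm (col j (Wpart (th 0))) = `|- Vpart (th 0) 0 j| by rewrite normrN.
have vinito j : - Vpart (th 0) 0 j != 0 by rewrite oppr_eq0.
have [rm [rm0 rm2 rmn umx mlim]] := class_limits (relu_flow_opp flow) yoP x0 mu0 sepo
  inito vinito ykmo vjm0 zjm0 gm0 um1 umg yim uim ummax.
have vsign j : 0 < Vpart (th 0) 0 j \/ Vpart (th 0) 0 j < 0.
  by have := vinit j; rewrite neq_lt => /orP[]; [right|left].
have rmp j : 0 < Vpart (th 0) 0 j -> rm j = 0 by move=> vj; apply: rmn; rewrite oppr_lt0.
(* The sign of an output weight never changes, so the two classes use disjoint sets of neurons;
   orthogonality of the class means rests on this. *)
have disj j : rp j = 0 \/ rm j = 0.
  by case: (vsign j) => [/rmp|/rpn]; [right|left].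
(* The limit of theta / sqrt (ln t), before normalisation. *)
pose lim_th := col_mx (\row_j (rp j - rm j))
  (\matrix_(k, j) (rp j * up k 0 + rm j * um k 0)) : 'M[R]_(1 + D, h).
have limV j : Vpart lim_th 0 j = rp j - rm j by rewrite mxE col_mxEu mxE.
have limW j : col j (Wpart lim_th) = rp j *: up + rm j *: um.
  by apply/matrixP => k l; rewrite ord1 2!mxE col_mxEd !mxE.
have VE t j : th t (lshift D 0) j = Vpart (th t) 0 j by rewrite mxE.
have WE t k j : th t (rshift 1 k) j = col j (Wpart (th t)) k 0 by rewrite 2!mxE.
have limE i j : th t i j / Num.sqrt (ln t) @[t --> +oo] --> lim_th i j.
  rewrite -(splitK i); case: (fintype.split i) => [l|k] /=.
    rewrite ord1 col_mxEu mxE; under eq_fun do rewrite VE.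
    case: (vsign j) => vj; first by rewrite (rmp _ vj) subr0; case: (plim j vj).
    rewrite (rpn _ vj) sub0r; have [|+ _] := mlim j; first by rewrite oppr_gt0.
    move=> /cvgN; apply: cvg_trans; apply: near_eq_cvg; apply: nearW => t /=.
    transitivity (- (- Vpart (th t) 0 j / Num.sqrt (ln t))) => //; by rewrite mulNr opprK.
  rewrite col_mxEd mxE; under eq_fun do rewrite WE.
  case: (vsign j) => vj.
    by rewrite (rmp _ vj) mul0r addr0; have [_] := plim j vj; apply.
  rewrite (rpn _ vj) mul0r add0r; have [|_] := mlim j; first by rewrite oppr_gt0.
  exact.
(* The squared Frobenius norm of the limit: u is a unit vector, so each neuron counts once in V and
   once in W. *)
pose N := 2 * (gp^-1 + gm^-1).
have N0 : 0 < N by rewrite mulr_gt0// addr_gt0 ?invr_gt0.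
have frobE : frob lim_th = Num.sqrt N.
  congr Num.sqrt; rewrite /frob_dot exchange_big /=.
  rewrite /N -rp2 -rm2 -big_split mulr_sumr; apply: eq_bigr => j _.
  rewrite big_split_ord big_ord1 /= !col_mxEu !mxE.
  have -> : \sum_(k < D) lim_th (rshift 1 k) j * lim_th (rshift 1 k) j =
      dotc (col j (Wpart lim_th)) (col j (Wpart lim_th)).
    by apply: eq_bigr => k _; rewrite !mxE.
  rewrite limW dotcDl !dotcDr !dotcZl !dotcZr -!sqr_enorm up1 um1.
  by case: (disj j) => ->; ring.
have frob0 : 0 < frob lim_th by rewrite frobE sqrtr_gt0.
have slimE t : 0 < t -> s_coef t gp gm * Num.sqrt t = (frob lim_th)^-1.
  move=> t0; rewrite frobE -sqrtrM ?divr_ge0 ?invr_ge0 ?(ltW t0) ?(ltW N0)//.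
  by rewrite mulrAC mulVf ?gt_eqF// mul1r sqrtrV// ltW.
have ln0 : \forall t \near +oo, 0 < Num.sqrt (ln t : R).
  by apply: filterS (@near_ln_ge R 1) => t [_ l1]; rewrite sqrtr_gt0; lra.
have featE i j : feat ((frob lim_th)^-1 *: lim_th) (x i) j 0 = (frob lim_th)^-1 *
    relu (rp j * dotc up (x i) + rm j * dotc um (x i)).
  rewrite mxE; have -> : col j (Wpart ((frob lim_th)^-1 *: lim_th)) =
      (frob lim_th)^-1 *: (rp j *: up + rm j *: um).
    by rewrite -limW; apply/matrixP => k l; rewrite !mxE.
  rewrite dotcZl dotcDl !dotcZl /relu.
  by rewrite maxr_pMr ?mulr0// invr_ge0 ltW.
have upP i : y i = 1 -> 0 <= dotc up (x i).
  by move=> yi; rewrite dotcC (le_trans (ltW gp0)) ?upg.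
have umP i : y i = -1 -> 0 <= dotc um (x i).
  by move=> yi; rewrite dotcC (le_trans (ltW gm0)) ?umg// yi opprK.
exists ((frob lim_th)^-1 *: lim_th); split; first exact: normalized_cvg ln0 frob0 limE.
(* The squares of [rp] sum to 1 / gp, so the factor [Num.sqrt gp] normalises; [slimE] shows that
   [s_coef] compensates it together with the Frobenius norm. *)
exists (\col_j (Num.sqrt gp * rp j)), (\col_j (Num.sqrt gm * rm j)).
have unit_norm g r : 0 < g -> \sum_j r j ^+ 2 = g^-1 ->
    enorm (\col_(j < h) (Num.sqrt g * r j)) = 1.
  move=> g0 r2; rewrite /enorm /dotc.
  rewrite (eq_bigr (fun j => g * r j ^+ 2)); last first.
    by move=> j _; rewrite !mxE -expr2 exprMn sqr_sqrtr// ltW.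
  by rewrite -mulr_sumr r2 divff ?sqrtr1 ?gt_eqF.
split; first exact: unit_norm.
split; first exact: unit_norm.
split.
  move=> i yi; apply/matrixP => j l; rewrite ord1 featE !mxE dotcZl -(slimE gp gp0).
  suff -> : relu (rp j * dotc up (x i) + rm j * dotc um (x i)) = rp j * dotc up (x i) by ring.
  have umi : dotc um (x i) <= 0 by rewrite dotcC; apply: umx; rewrite yi.
  case: (disj j) => ->; rewrite mul0r ?add0r ?addr0.
    by rewrite relu_neg// mulr_ge0_le0.
  by rewrite relu_pos// mulr_ge0 ?upP.
split.
  move=> i yi; apply/matrixP => j l; rewrite ord1 featE !mxE dotcZl -(slimE gm gm0).
  suff -> : relu (rp j * dotc up (x i) + rm j * dotc um (x i)) = rm j * dotc um (x i) by ring.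
  have upi : dotc up (x i) <= 0 by rewrite dotcC upx.
  case: (disj j) => ->; rewrite mul0r ?add0r ?addr0.
    by rewrite relu_pos// mulr_ge0 ?umP.
  by rewrite relu_neg// mulr_ge0_le0.
split; first by move=> j; rewrite mxE mulr_ge0 ?sqrtr_ge0.
split; first by move=> j; rewrite mxE mulr_ge0 ?sqrtr_ge0.
split.
  apply: big1 => j _; rewrite !mxE.
  by case: (disj j) => ->; rewrite !(mulr0, mul0r).
apply/matrixP => l j; rewrite ord1.
have -> : Vpart ((frob lim_th)^-1 *: lim_th) 0 j = (frob lim_th)^-1 * Vpart lim_th 0 j.
  by rewrite !mxE.
by rewrite limV mulrBr -{1}(slimE gp gp0) -(slimE gm gm0) !mxE !mulrA.
Qed.
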